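(* Let $d\ge1$ be an integer. For $n\ge1$ let $HB^d(n)$ be the set of triples $\alpha=(m,b,\mathbf k)$ where $m\ge d$ is an integer, $b\in B(m,d)$, and $\mathbf k=(k_0,d,k_1,d,\dots,d,k_n)$ is a type with $n$ nuclei and $|\mathbf k|=m$. For $\alpha_0=(m_0,b_0,\mathbf k_0)\in HB^d(n)$ with $\mathbf k_0=(k_0,d,k_1,d,\dots,d,k_n)$ and $\alpha_i=(m'_i,b_i,\mathbf k_i)\in HB^d(m_i)$, $1\le i\le n$, define $\gamma(\alpha_0;\alpha_1,\dots,\alpha_n)\in HB^d(m_1+\cdots+m_n)$ to be the triple whose type is the composition of types $\gamma(\mathbf k_0;\mathbf k_1,\dots,\mathbf k_n)$ and whose higher Bruhat order is $$\Big(\cdots\big((b_0\circ_{k_0}b_1)\circ_{k_0+m'_1+k_1}b_2\big)\cdots\Big)\circ_{k_0+m'_1+k_1+m'_2+\cdots+m'_{n-1}+k_{n-1}}b_n .$$ Then the collection $HB^d=\{HB^d(n)\}_{n\ge1}$ with these compositions is a planar operad of sets. Moreover, there is an embedding of operads $HB_0^d\subset HB^d$, sending $b\in HB_0^d(n)=B(nd,d)$ to $(nd,b,(0,d,0,\dots,0,d,0))$.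
   Context: **Notation.** $[n]=\{1,\dots,n\}$, $[0]=\emptyset$; for an integer $a$, $a+[n]=\{a+1,\dots,a+n\}$; $\binom{[n]}{d}$ is the set of $d$-element subsets of $[n]$. **Higher Bruhat orders.** Let $1\le d\le n$. For $\mathbf i=\{i_1<\dots<i_{r}\}$ let $\hat{\mathbf i}_k=\mathbf i\setminus\{i_k\}$; the packet of $\mathbf i$ is the sequence $P(\mathbf i)=(\hat{\mathbf i}_{r},\hat{\mathbf i}_{r-1},\dots,\hat{\mathbf i}_1)$. A linear order on $\binom{[n]}{d}$ is admissible if for every $\mathbf i\in\binom{[n]}{d+1}$ its restriction to $P(\mathbf i)$ is either lexicographical ($\hat{\mathbf i}_{d+1}\prec\cdots\prec\hat{\mathbf i}_1$) or antilexicographical ($\hat{\mathbf i}_{d+1}\succ\cdots\succ\hat{\mathbf i}_1$). Its inversion set $Inv\subset\binom{[n]}{d+1}$ consists of those $\mathbf i$ for which the restriction to $P(\mathbf i)$ is antilexicographical. $B(n,d)$ is the set of admissible orders modulo the relation of having the same inversion set; so an element of $B(n,d)$ is determined by its inversion set. $B(d,d)$ has exactly one element. A known theorem of Ziegler says that $I\subset\binom{[n]}{d+1}$ is the inversion set of an element of $B(n,d)$ if and only if for each $\mathbf i\in\binom{[n]}{d+2}$ the set $I\cap P(\mathbf i)$ is an initial or a final segment (possibly empty or everything) of the sequence $P(\mathbf i)$. **Insertion.** Let $n,m\ge d$, $0\le j\le n-d$, $\prec\in B(n,d)$, $\prec'\in B(m,d)$. Write $[n+m-d]=A\sqcup B\sqcup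 C$ with $A=[j]$, $B=j+[m]$, $C=j+m+[n-(j+d)]$, and let $D=j+[d]\subset B$. Let $\phi:[n]\to A\cup D\cup C$ be the monotone bijection. Then $\prec\circ_j\prec'\in B(n+m-d,d)$ is the element whose inversion set is the set of $(d+1)$-subsets $L\subset[n+m-d]$ such that: (i) if $L\subset B$: $L-j\in Inv(\prec')$; (ii) if $L\subset A\cup D\cup C$: $\phi^{-1}(L)\in Inv(\prec)$; (iii) otherwise: $\phi^{-1}(\overline L)\in Inv(\prec)$, where $L^+=L\cap(A\cup D\cup C)$, $L^-=L\cap(B\setminus D)$, and $\overline L$ is the union of $L^+$ with the $|L^-|$ rightmost (largest) elements of $D\setminus L^+$. **Types.** A type with $n\ge 1$ nuclei is a sequence $\mathbf k=(k_0,d,k_1,d,\dots,d,k_n)$ with integers $k_i\ge0$; $|\mathbf k|=nd+\sum_i k_i$. It describes the interval $[|\mathbf k|]$ divided into (from left to right) $k_0$ ''electrons'', a ''nucleus'' of $d$ consecutive elements, $k_1$ electrons, a nucleus, and so on. Composition of types: for $\mathbf k=(k_0,d,\dots,d,k_n)$ and $\mathbf m_i=(m^i_0,d,\dots,d,m^i_{l_i})$, $1\le i\le n$, the type $\gamma(\mathbf k;\mathbf m_1,\dots,\mathbf m_n)$ with $l_1+\dots+l_n$ nuclei is obtained by replacing the $i$-th nucleus of $\mathbf k$ by the whole $\mathbf m_i$ and adding adjacent numbers of electrons: $(k_0+m^1_0,d,m^1_1,d,\dots,m^1_{l_1-1},d,k_1+m^1_{l_1}+m^2_0,d,m^2_1,\dots,d,k_{n-1}+m^{n-1}_{l_{n-1}}+m^n_0,d,m^n_1,\dots,m^n_{l_n-1},d,k_n+m^n_{l_n})$.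 **Small Bruhat operad.** $HB_0^d(n)=B(nd,d)$, $n\ge1$, with composition $\gamma(b_0;b_1,\dots,b_n)=(\cdots((b_0\circ_0b_1)\circ_{dm_1}b_2)\cdots)\circ_{dm_1+\cdots+dm_{n-1}}b_n$ for $b_0\in B(nd,d)$, $b_i\in B(m_id,d)$; its unit is the unique element of $B(d,d)$. **Planar operad of sets.** Sets $\mathcal O(n)$, $n\ge1$, maps $\gamma:\mathcal O(k)\times\mathcal O(n_1)\times\cdots\times\mathcal O(n_k)\to\mathcal O(n_1+\cdots+n_k)$ and an element $I\in\mathcal O(1)$ such that $\gamma(\gamma(a;b_1,\dots,b_k);c_{1,1},\dots,c_{1,n_1},\dots,c_{k,1},\dots,c_{k,n_k})=\gamma(a;\gamma(b_1;c_{1,1},\dots,c_{1,n_1}),\dots,\gamma(b_k;c_{k,1},\dots,c_{k,n_k}))$, $\gamma(a;I,\dots,I)=a$ and $\gamma(I;a)=a$ (no symmetric group action). An embedding of operads is a family of injective maps compatible with $\gamma$ and units. *)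

(* Defs.v *)
From HB Require Import structures.
From mathcomp Require Import all_boot all_order.
From mathcomp Require Import zify.

Set Implicit Arguments.
Unset Strict Implicit.
Unset Printing Implicit Defensive.

Local Open Scope quotient_scope.

(* The set [n] = {1, ..., n} is represented by 'I_n = {0, ..., n-1}; every
   position below is shifted accordingly. *)

Definition dsubs (n d : nat) : {set {set 'I_n}} :=
  [set A : {set 'I_n} | #|A| == d].

(* (L \ i_r, ..., L \ i_1) for L = {i_1 < ... < i_r}; enum L is increasing. *)
Definition packet (n : nat) (L : {set 'I_n}) : seq {set 'I_n} :=
  [seq L :\ x | x <- rev (enum L)].

(* A strict order on a set of subsets is given by its graph. *)
Definition precs (n : nat) (R : {set {set 'I_n} * {set 'I_n}}) :
  rel {set 'I_n} := fun A B => (A, B) \in R.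

Definition linear_order (n d : nat) (R : {set {set 'I_n} * {set 'I_n}}) : bool :=
  [&& R \subset setX (dsubs n d) (dsubs n d),
      [forall A in dsubs n d, ~~ precs R A A],
      [forall A in dsubs n d, forall B in dsubs n d, forall C in dsubs n d,
         precs R A B ==> precs R B C ==> precs R A C] &
      [forall A in dsubs n d, forall B in dsubs n d,
         (A != B) ==> precs R A B || precs R B A]].

Definition lexicographic (n : nat) (R : {set {set 'I_n} * {set 'I_n}})
  (L : {set 'I_n}) : bool := sorted (precs R) (packet L).

Definition antilexicographic (n : nat) (R : {set {set 'I_n} * {set 'I_n}})
  (L : {set 'I_n}) : bool := sorted (fun A B => precs R B A) (packet L).

Definition admissible (n d : nat) (R : {set {set 'I_n} * {set 'I_n}}) : bool :=
  linear_order d R &&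
  [forall L in dsubs n d.+1, lexicographic R L || antilexicographic R L].

Record adm_order (n d : nat) := AdmOrder {
  adm_rel : {set {set 'I_n} * {set 'I_n}};
  adm_relP : admissible d adm_rel }.

HB.instance Definition _ n d := [isSub for @adm_rel n d].
HB.instance Definition _ n d := [Finite of adm_order n d by <:].

Definition inversions (n d : nat) (R : adm_order n d) : {set {set 'I_n}} :=
  [set L in dsubs n d.+1 | antilexicographic (adm_rel R) L].

Definition same_inv (n d : nat) : rel (adm_order n d) :=
  fun R S => inversions R == inversions S.

Lemma same_inv_equiv n d : equiv_class_of (@same_inv n d).
Proof.
split=> [R | R S | S R T]; rewrite /same_inv //.
by move=> /eqP-> /eqP->.
Qed.

Canonical same_inv_equivrel n d := EquivRelPack (same_inv_equiv n d).

Definition bruhat (n d : nat) : Type := {eq_quot @same_inv_equivrel n d}.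

Definition Inv (n d : nat) (b : bruhat n d) : {set {set 'I_n}} :=
  inversions (repr b).

Lemma Inv_pi n d (R : adm_order n d) :
  Inv (\pi_({eq_quot @same_inv_equivrel n d}) R) = inversions R.
Proof. by rewrite /Inv; case: piP => S /eqmodP/eqP. Qed.

Lemma Inv_inj n d : injective (@Inv n d).
Proof.
move=> b c; rewrite /Inv => e.
by rewrite -[b]reprK -[c]reprK; apply/eqmodP/eqP.
Qed.

(* The lexicographic order: A precedes B when the least element on which they
   differ belongs to A. Its class is the element of B(n,d) without inversions,
   which is the only element when n = d. *)
Definition lexlt (n : nat) (A B : {set 'I_n}) : bool :=
  [exists x : 'I_n, [&& x \in A, x \notin B &
     [forall y : 'I_n, (y < x) ==> ((y \in A) == (y \in B))]]].

Definition lexrel (n d : nat) : {set {set 'I_n} * {set 'I_n}} :=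
  [set p in setX (dsubs n d) (dsubs n d) | lexlt p.1 p.2].

Lemma lexltP n (A B : {set 'I_n}) :
  reflect (exists x : 'I_n, [/\ x \in A, x \notin B &
             forall y : 'I_n, y < x -> (y \in A) = (y \in B)])
          (lexlt A B).
Proof.
apply: (iffP existsP) => -[x].
  case/and3P=> xA xB /forallP h; exists x; split=> // y yx.
  by have /implyP/(_ yx)/eqP := h y.
by case=> xA xB h; exists x; rewrite xA xB; apply/forallP=> y;
  apply/implyP=> /h->.
Qed.

Lemma lexlt_trans n : transitive (@lexlt n).
Proof.
move=> B A C /lexltP[x [xA xB hx]] /lexltP[y [yB yC hy]]; apply/lexltP.
have [xy|yx|exy] := ltngtP x y.
- exists x; split=> //; first by rewrite -hy.
  by move=> z zx; rewrite hx // hy //; apply: ltn_trans zx xy.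
- exists y; split=> //; first by rewrite hx.
  by move=> z zy; rewrite hx ?hy //; apply: ltn_trans zy yx.
- by rewrite (val_inj exy) yB in xB.
Qed.

Lemma lexlt_total n (A B : {set 'I_n}) : A != B -> lexlt A B || lexlt B A.
Proof.
move=> neAB.
have [x0 Px0] : exists x : 'I_n, (x \in A) != (x \in B).
  apply/existsP; apply: contraNT neAB; rewrite negb_exists => /forallP h.
  by apply/eqP/setP=> x; apply/eqP; have := h x; rewrite negbK.
have [x Px minx] := @arg_minnP _ x0 (fun x : 'I_n => (x \in A) != (x \in B))
  (fun x => val x) Px0.
have hx (y : 'I_n) : y < x -> (y \in A) = (y \in B).
  by move=> yx; apply/eqP; apply: contraLR yx => /minx; rewrite -leqNgt.
case xA: (x \in A) Px; case xB: (x \in B) => // _.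
- by apply/orP; left; apply/lexltP; exists x; rewrite xA xB.
- by apply/orP; right; apply/lexltP; exists x; rewrite xA xB; split=> // y /hx.
Qed.

Lemma sorted_enum_ord n (L : {set 'I_n}) :
  sorted (fun x y : 'I_n => x < y) (enum L).
Proof.
rewrite {1}/enum_mem -enumT; apply: sorted_filter.
  by move=> x y z; apply: ltn_trans.
have : sorted ltn (map val (enum 'I_n)).
  by rewrite val_enum_ord iota_ltn_sorted.
by rewrite sorted_map.
Qed.

Lemma lexrel_admissible n d : admissible d (lexrel n d).
Proof.
have E A B : precs (lexrel n d) A B =
    [&& A \in dsubs n d, B \in dsubs n d & lexlt A B].
  by rewrite /precs inE in_setX /= andbA.
apply/andP; split.
  apply/and4P; split.
  - by apply/subsetP=> p; rewrite inE => /andP[].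
  - apply/forall_inP=> A _; rewrite E !negb_and.
    have -> : lexlt A A = false by apply/lexltP=> -[x [->]].
    by rewrite !orbT.
  - apply/forall_inP=> A _; apply/forall_inP=> B _; apply/forall_inP=> C _.
    rewrite !E; apply/implyP=> /and3P[-> _ AB].
    by apply/implyP=> /and3P[_ -> BC]; rewrite (lexlt_trans AB BC).
  - apply/forall_inP=> A AD; apply/forall_inP=> B BD; apply/implyP.
    by rewrite !E AD BD; apply: lexlt_total.
apply/forall_inP=> L; rewrite inE => /eqP cL; apply/orP; left.
have D x : x \in L -> L :\ x \in dsubs n d.
  by move=> xL; have := cardsD1 x L; rewrite cL xL inE => -[->].
rewrite /lexicographic /packet sorted_map rev_sorted.
apply: (@sub_in_sorted _ (mem L) (fun x y : 'I_n => x < y)); last first.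
- exact: sorted_enum_ord.
- by apply/allP=> x; rewrite mem_enum.
move=> x y xL yL xy /=; rewrite E !D //=; apply/lexltP; exists x.
rewrite !inE xL eqxx andbT; split=> //; first by rewrite neq_ltn xy.
move=> z zx; rewrite !inE; congr (_ && _).
by rewrite !neq_ltn zx (ltn_trans zx xy).
Qed.

Definition lexB (n d : nat) : bruhat n d :=
  \pi_({eq_quot @same_inv_equivrel n d}) (AdmOrder (lexrel_admissible n d)).

Section Insertion.
Variables (d n m j : nat).
Local Notation N := (n + m - d).

Definition secA : {set 'I_N} := [set x : 'I_N | x < j].
Definition secB : {set 'I_N} := [set x : 'I_N | (j <= x) && (x < j + m)].
Definition secC : {set 'I_N} := [set x : 'I_N | j + m <= x].
Definition secD : {set 'I_N} := [set x : 'I_N | (j <= x) && (x < j + d)].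

(* The monotone bijection from [n] onto A \cup D \cup C. *)
Definition phi (i : nat) : nat := if i < j + d then i else i + (m - d).

Definition phi_inv (L : {set 'I_N}) : {set 'I_n} :=
  [set i : 'I_n | [exists x in L, x == phi i :> nat]].

Definition shift_inv (L : {set 'I_N}) : {set 'I_m} :=
  [set i : 'I_m | [exists x in L, x == j + i :> nat]].

Definition Lplus (L : {set 'I_N}) : {set 'I_N} :=
  L :&: (secA :|: secD :|: secC).

Definition Lminus (L : {set 'I_N}) : {set 'I_N} := L :&: (secB :\: secD).

Definition Lbar (L : {set 'I_N}) : {set 'I_N} :=
  Lplus L :|: [set x in take #|Lminus L| (rev (enum (secD :\: Lplus L)))].

Definition insertion_set (I : {set {set 'I_n}}) (J : {set {set 'I_m}}) :
  {set {set 'I_N}} :=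
  [set L in dsubs N d.+1 |
     if L \subset secB then shift_inv L \in J
     else if L \subset secA :|: secD :|: secC then phi_inv L \in I
     else phi_inv (Lbar L) \in I].

End Insertion.
Arguments insertion_set d {n m} j I J.

(* The element of B(n+m-d, d) with inversion set [insertion_set]. The default
   value is irrelevant as soon as [insertion_well_defined] holds. *)
Definition insertion (d n m j : nat) (b : bruhat n d) (b' : bruhat m d) :
  bruhat (n + m - d) d :=
  if [pick R : adm_order (n + m - d) d |
        inversions R == insertion_set d j (Inv b) (Inv b')] is Some R
  then \pi_({eq_quot @same_inv_equivrel (n + m - d) d}) R
  else lexB (n + m - d) d.

Definition insertion_well_defined (d : nat) : Prop :=
  forall (n m j : nat) (b : bruhat n d) (b' : bruhat m d),
    d <= n -> d <= m -> j <= n - d ->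
    Inv (insertion j b b') = insertion_set d j (Inv b) (Inv b').

(* Higher Bruhat orders together with the size of their ground set; iterated
   insertions are computed there, to avoid transporting along equalities of
   sizes at each step. *)
Definition bruhats (d : nat) : Type := {n : nat & bruhat n d}.

Definition mkB (d n : nat) (b : bruhat n d) : bruhats d :=
  existT (fun n => bruhat n d) n b.

Definition insertT (d : nat) (x : bruhats d) (p : nat * bruhats d) : bruhats d :=
  mkB (insertion p.1 (projT2 x) (projT2 p.2)).

(* ( ... ((b0 o_{pos 0} b 0) o_{pos 1} b 1) ... ) o_{pos (k-1)} b (k-1) *)
Definition insert_all (d k : nat) (b0 : bruhats d) (pos : 'I_k -> nat)
  (b : 'I_k -> bruhats d) : bruhats d :=
  foldl (@insertT d) b0 [seq (pos i, b i) | i <- enum 'I_k].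

Lemma insert_all_size d k (b0 : bruhats d) pos (b : 'I_k -> bruhats d) :
  d <= projT1 b0 -> (forall i, d <= projT1 (b i)) ->
  d <= projT1 (insert_all b0 pos b) /\
  projT1 (insert_all b0 pos b) + k * d = projT1 b0 + \sum_(i < k) projT1 (b i).
Proof.
move=> h0 hb; rewrite /insert_all.
have -> : k * d = size (enum 'I_k) * d by rewrite size_enum_ord.
rewrite -[\sum_(i < k) _]big_enum /=.
elim: (enum 'I_k) b0 h0 => [|i s IHs] b0 h0 /=; first by rewrite big_nil; lia.
have hi := hb i; rewrite big_cons mulSn.
have h1 : d <= projT1 (insertT b0 (pos i, b i)) by rewrite /=; lia.
by have [? /=] := IHs _ h1; split=> //; lia.
Qed.

(* A family (O(n)), n >= 1, is given by a function on nat,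
   of which only the values at positive integers are used. *)
Lemma sum_pos k (n : 'I_k -> nat) :
  0 < k -> (forall i, 0 < n i) -> 0 < \sum_(i < k) n i.
Proof.
by case: k n => // k n _ hn; rewrite big_ord_recl; have := hn ord0; lia.
Qed.

Record operad_data := OperadData {
  op_set : nat -> Type;
  op_comp : forall (k : nat) (n : 'I_k -> nat), 0 < k -> (forall i, 0 < n i) ->
    op_set k -> (forall i, op_set (n i)) -> op_set (\sum_(i < k) n i);
  op_unit : op_set 1 }.

(* Equality of elements of O(n) and O(m) where n = m is only provable. *)
Definition op_eq (O : operad_data) (n m : nat) (x : op_set O n)
  (y : op_set O m) : Prop :=
  existT (op_set O) n x = existT (op_set O) m y.

(* tagnat.sig1 s and tagnat.sig2 s are the indices i and j of the s-th term of
   (c_{1,1}, ..., c_{1,n_1}, ..., c_{k,1}, ..., c_{k,n_k}). *)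
Definition is_planar_operad (O : operad_data) : Prop :=
  [/\ forall (k : nat) (n : 'I_k -> nat) (p : forall i, 'I_(n i) -> nat)
        (hk : 0 < k) (hn : forall i, 0 < n i) (hp : forall i j, 0 < p i j)
        (a : op_set O k) (b : forall i, op_set O (n i))
        (c : forall i j, op_set O (p i j)),
        op_eq
          (op_comp (sum_pos hk hn)
             (fun s => hp (tagnat.sig1 s) (tagnat.sig2 s))
             (op_comp hk hn a b)
             (fun s => c (tagnat.sig1 s) (tagnat.sig2 s)))
          (op_comp hk (fun i => sum_pos (hn i) (hp i)) a
             (fun i => op_comp (hn i) (hp i) (b i) (c i))),
      forall (k : nat) (hk : 0 < k) (a : op_set O k),
        op_eq (op_comp hk (fun _ => ltn0Sn 0) a (fun _ => op_unit O)) a &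
      forall (n : nat) (hn : 0 < n) (a : op_set O n),
        op_eq (op_comp (ltn0Sn 0) (fun _ => hn) (op_unit O) (fun _ => a)) a].

Definition is_operad_embedding (O P : operad_data)
  (f : forall n, 0 < n -> op_set O n -> op_set P n) : Prop :=
  [/\ forall (n : nat) (hn : 0 < n), injective (f n hn),
      forall (k : nat) (n : 'I_k -> nat) (hk : 0 < k) (hn : forall i, 0 < n i)
        (a : op_set O k) (b : forall i, op_set O (n i)),
        f _ (sum_pos hk hn) (op_comp hk hn a b) =
        op_comp hk hn (f k hk a) (fun i => f (n i) (hn i) (b i)) &
      f 1 (ltn0Sn 0) (op_unit O) = op_unit P].

Definition HB0 (d n : nat) : Type := bruhat (n * d) d.

Definition HB0_pos (d k : nat) (n : 'I_k -> nat) (i : 'I_k) : nat :=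
  d * \sum_(l < k | l < i) n l.

Definition HB0_insert (d k : nat) (n : 'I_k -> nat) (b0 : HB0 d k)
  (b : forall i, HB0 d (n i)) : bruhats d :=
  insert_all (mkB b0) (HB0_pos d n) (fun i => mkB (b i)).

Lemma HB0_insert_size d k (n : 'I_k -> nat) (b0 : HB0 d k)
  (b : forall i, HB0 d (n i)) : 0 < k -> (forall i, 0 < n i) ->
  projT1 (HB0_insert b0 b) = (\sum_(i < k) n i) * d.
Proof.
move=> hk hn.
have [||_] := @insert_all_size d k (mkB b0) (HB0_pos d n) (fun i => mkB (b i)).
- by rewrite /= leq_pmull.
- by move=> i; rewrite /= leq_pmull.
by rewrite /= -big_distrl /= -/(HB0_insert b0 b) addnC => /addnI.
Qed.

Definition HB0_comp (d k : nat) (n : 'I_k -> nat) (hk : 0 < k)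
  (hn : forall i, 0 < n i) (b0 : HB0 d k) (b : forall i, HB0 d (n i)) :
  HB0 d (\sum_(i < k) n i) :=
  ecast N (bruhat N d) (HB0_insert_size b0 b hk hn) (projT2 (HB0_insert b0 b)).

Definition HB0_operad (d : nat) : operad_data :=
  OperadData (@HB0_comp d) (lexB (1 * d) d).

(* A type (k_0, d, k_1, d, ..., d, k_n) is encoded by (k_0, ..., k_n). *)
Definition nuclei_type (n : nat) : Type := {ffun 'I_n.+1 -> nat}.

Definition type_size (d n : nat) (k : nuclei_type n) : nat :=
  n * d + \sum_(i < n.+1) k i.

(* The nuclei of gamma(k; m_1, ..., m_n) coming from m_i are preceded by
   l_1 + ... + l_{i-1} others, so the entry of index t of gamma(k; m_1, ..., m_n)
   collects the k_i with l_1 + ... + l_i = t and the m^i_p with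
   l_1 + ... + l_{i-1} + p = t. *)
Definition nuclei_before (n : nat) (l : 'I_n -> nat) (i : nat) : nat :=
  \sum_(q < n | q < i) l q.

Definition type_comp (n : nat) (l : 'I_n -> nat) (k : nuclei_type n)
  (m : forall i, nuclei_type (l i)) : nuclei_type (\sum_(i < n) l i) :=
  [ffun t : 'I_(\sum_(i < n) l i).+1 =>
     \sum_(i < n.+1 | nuclei_before l i == t) k i +
     \sum_(i < n) \sum_(p < (l i).+1 | nuclei_before l i + p == t) m i p].

Lemma nuclei_before_le n (l : 'I_n -> nat) i :
  nuclei_before l i <= \sum_(q < n) l q.
Proof. by rewrite [leqRHS](bigID (fun q : 'I_n => q < i)) leq_addr. Qed.

Lemma nuclei_before_add_le n (l : 'I_n -> nat) (i : 'I_n) (p : 'I_(l i).+1) :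
  nuclei_before l i + p <= \sum_(q < n) l q.
Proof.
rewrite [leqRHS](bigID (fun q : 'I_n => q < i)) /= leq_add2l.
rewrite (bigD1 i) ?ltnn //=; have := ltn_ord p; lia.
Qed.

Lemma sum_fiber N (T : finType) (f g : T -> nat) : (forall i, g i <= N) ->
  \sum_(t < N.+1) \sum_(i | g i == t) f i = \sum_i f i.
Proof.
move=> hg; rewrite (exchange_big_dep predT) //=; apply: eq_bigr => i _.
have hi : g i < N.+1 by rewrite ltnS.
by rewrite (big_pred1 (Ordinal hi)) // => t; rewrite -val_eqE /= eq_sym.
Qed.

Lemma type_comp_size d n (l : 'I_n -> nat) (k : nuclei_type n)
  (m : forall i, nuclei_type (l i)) :
  type_size d (type_comp k m) + n * d =
  type_size d k + \sum_(i < n) type_size d (m i).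
Proof.
rewrite /type_size big_split /= -big_distrl /=.
have -> : \sum_(t < (\sum_(i < n) l i).+1) type_comp k m t =
    \sum_i k i + \sum_(i < n) \sum_p m i p.
  under [LHS]eq_bigr do rewrite ffunE.
  rewrite big_split /= sum_fiber; last by move=> i; apply: nuclei_before_le.
  congr (_ + _); rewrite exchange_big; apply: eq_bigr => i _.
  by rewrite sum_fiber // => p; apply: nuclei_before_add_le.
by rewrite addnAC [RHS]addnAC -!addnA addnCA; do 2 congr (_ + _); apply: addnC.
Qed.

Record HB (d n : nat) := mkHB {
  HB_size : nat;
  HB_order : bruhat HB_size d;
  HB_type : nuclei_type n;
  HB_size_ge : d <= HB_size;
  HB_type_size : type_size d HB_type = HB_size }.

(* k_0 + m'_1 + k_1 + ... + m'_{i-1} + k_{i-1} for the i-th insertion, that is,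
   for the index i - 1 : 'I_k. *)
Definition HB_pos (d k : nat) (n : 'I_k -> nat) (a0 : HB d k)
  (a : forall i, HB d (n i)) (i : 'I_k) : nat :=
  \sum_(l < k.+1 | l <= i) HB_type a0 l + \sum_(l < k | l < i) HB_size (a l).

Definition HB_insert (d k : nat) (n : 'I_k -> nat) (a0 : HB d k)
  (a : forall i, HB d (n i)) : bruhats d :=
  insert_all (mkB (HB_order a0)) (HB_pos a0 a) (fun i => mkB (HB_order (a i))).

Lemma HB_insert_ge d k (n : 'I_k -> nat) (a0 : HB d k)
  (a : forall i, HB d (n i)) : d <= projT1 (HB_insert a0 a).
Proof.
have [||//] := @insert_all_size d k (mkB (HB_order a0)) (HB_pos a0 a)
  (fun i => mkB (HB_order (a i))).
- exact: HB_size_ge.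
- by move=> i; apply: HB_size_ge.
Qed.

Lemma HB_insert_size d k (n : 'I_k -> nat) (a0 : HB d k)
  (a : forall i, HB d (n i)) :
  type_size d (type_comp (HB_type a0) (fun i => HB_type (a i))) =
  projT1 (HB_insert a0 a).
Proof.
have [||_] := @insert_all_size d k (mkB (HB_order a0)) (HB_pos a0 a)
  (fun i => mkB (HB_order (a i))).
- exact: HB_size_ge.
- by move=> i; apply: HB_size_ge.
rewrite -/(HB_insert a0 a) /= => e; apply/(@addIn (k * d)).
rewrite e type_comp_size HB_type_size; congr (_ + _).
by apply: eq_bigr => i _; apply: HB_type_size.
Qed.

Definition HB_comp (d k : nat) (n : 'I_k -> nat) (hk : 0 < k)
  (hn : forall i, 0 < n i) (a0 : HB d k) (a : forall i, HB d (n i)) :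
  HB d (\sum_(i < k) n i) :=
  mkHB (projT2 (HB_insert a0 a)) (HB_insert_ge a0 a) (HB_insert_size a0 a).

Definition HB_operad (d : nat) (u : HB d 1) : operad_data :=
  OperadData (@HB_comp d) u.

Lemma zero_type_size d n :
  type_size d ([ffun=> 0] : nuclei_type n) = n * d.
Proof. by rewrite /type_size big1 ?addn0 // => i _; rewrite ffunE. Qed.

Definition HB_incl (d n : nat) (hn : 0 < n) (b : HB0 d n) : HB d n :=
  @mkHB d n (n * d) b [ffun=> 0] (leq_pmull d hn) (zero_type_size d n).

(* Main.v *)
Require Import Defs.
From mathcomp Require Import all_boot all_order.
From mathcomp Require Import zify.
From Stdlib Require Import FunctionalExtensionality Eqdep_dec.

(** An element of [B(N,d)] is determined by its inversion set, and by Ziegler's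
    theorem the inversion sets are the consistent ones ([consistent_inversions],
    [inversions_consistent]). Everything is therefore a statement about
    [(d+1)]-subsets, which are handled as increasing sequences
    [f 0 < ... < f d].

    Whether such a sequence is an inversion of [x o_j y] is decided as follows
    ([inv_insertT]): if it lies in the block of [m] elements that replaces the
    nucleus, ask [y]; otherwise ask [x] about the sequence [collapse f], in which
    the elements right of the block are moved to the left by [m - d] and those in
    the block are pressed into the nucleus as far to the right as possible
    without moving any of them to the right. Explicitly,
    [collapse f i = min (f i) (j + d + i - e)] for [i < e], with [e] the number
    of elements that are smaller than [j + m]. In this form the reduction from
    the definition of insertion is accessible to linear arithmetic.

    Insertion preserves consistency ([insertion_consistent]) because [collapse]
    is compatible with the deletion of elements up to a monotone change of the
    index of the deleted one ([collapse_face]), so packets go to packets; only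
    sets with [d+1] or [d+2] elements in the block need a separate argument.

    Collapsing an inner block and then the outer one amounts to collapsing the
    large block at once, and the collapses of disjoint blocks commute. This gives
    the two laws of partial compositions, [insertT_assoc] and [insertT_comm]. The
    general associativity of [gamma] follows by sorting a list of insertions
    ([foldl_blocks]): in [gamma (gamma (a; b); c)] all the [b_i] are inserted
    before the [c_ij], and [insertT_comm] moves the [c_ij] to the left past
    [b_(i+1), b_(i+2), ...], until they follow [b_i]; then [insertT_assoc]
    gathers [b_i] and its [c_ij] into [gamma (b_i; c_i)]. What remains is that
    the types, and the positions computed from them, agree on both sides
    ([type_comp_assoc], [HB_pos_flat]).

    The inclusion of the small operad is injective and respects composition, as
    types without electrons put the nuclei at the multiples of [d]. Hence the
    axioms of the small operad are inherited from those of the large one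
    ([operad_embedding]). *)

Set Implicit Arguments.
Unset Strict Implicit.
Unset Printing Implicit Defensive.

(** * Inversion sets are the consistent sets *)

(** For Boolean sequences, being constant on an initial and on the
    complementary final segment amounts to the absence of the patterns
    in-out-in and out-in-out. *)
Definition consistent N (S : {set 'I_N}) (d : nat) (U : {set {set 'I_N}}) :=
  forall (P : {set 'I_N}) (x y z : 'I_N), P \subset S -> #|P| = d.+2 ->
    x \in P -> y \in P -> z \in P -> x < y -> y < z ->
    (P :\ x \in U) = (P :\ z \in U) -> (P :\ y \in U) = (P :\ x \in U).

Lemma cardD1_eq N (L : {set 'I_N}) x r :
  x \in L -> #|L| = r.+1 -> #|L :\ x| = r.
Proof. by move=> xL; rewrite (cardsD1 x L) xL => -[]. Qed.

Lemma setD1_inj N (L : {set 'I_N}) x y :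
  x \in L -> L :\ x = L :\ y -> x = y.
Proof.
move=> xL /setP/(_ x); rewrite !inE eqxx xL andbT /=.
by case: eqP.
Qed.

Lemma bounded_rank N (f : {set 'I_N} -> nat) : exists M, forall K, f K < M.
Proof.
exists (\max_K f K).+1 => K; rewrite ltnS.
exact: (@leq_bigmax _ f K).
Qed.

(** The order is represented by an injective rank function [f]. Remove the largest element [t]
    of the ground set. The sets avoiding [t] are ordered by the restriction of
    [U], those containing [t] by the contraction [U/t]; the latter are placed
    as one block after all the sets [K] with [t |: K \notin U] and before all
    those with [t |: K \in U], as the packets of the sets [t |: K] demand.
    Consistency on the packets of the sets [t |: L] shows that separating the
    sets avoiding [t] in this way respects the packet of [L]. *)
Lemma consistent_rank N d (S : {set 'I_N}) (U : {set {set 'I_N}}) :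
  consistent S d U ->
  exists f : {set 'I_N} -> nat,
    (forall A B : {set 'I_N}, A \subset S -> B \subset S ->
       #|A| = d -> #|B| = d -> f A = f B -> A = B) /\
    (forall (L : {set 'I_N}) (x y : 'I_N), L \subset S -> #|L| = d.+1 ->
       x \in L -> y \in L -> x < y -> (f (L :\ y) < f (L :\ x)) = (L \notin U)).
Proof.
elim: {S}_.+1 {-2}S (ltnSn #|S|) d U => // n IHn S cS d U consU.
have [->|[t0 t0S]] := set_0Vmem S.
  exists (fun=> 0); split=> [A B|L x y].
    by rewrite !subset0 => /eqP-> /eqP->.
  by rewrite subset0 => /eqP->; rewrite cards0.
case: d consU => [|d] consU.
  exists (fun=> 0); split=> [A B _ _ /cards0_eq-> /cards0_eq-> //|L x y _ cL].
  move=> xL yL xy; have /eqP/cards1P[u eL] := cL.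
  by move: xL yL xy; rewrite eL !inE => /eqP-> /eqP->; rewrite ltnn.
have [t tS maxt] : exists2 t, t \in S & forall x, x \in S -> x <= t.
  by have [t tS h] := @arg_maxnP _ t0 (mem S) (fun x => val x) t0S; exists t.
have cS' : #|S :\ t| < n by move: cS; rewrite (cardsD1 t S) tS.
pose V : {set {set 'I_N}} := [set K | t |: K \in U].
have [|f1 [inj1 pk1]] := IHn _ cS' d.+1 U.
  by move=> P x y z /subset_trans sP; apply/consU/sP/subsetDl.
have [|f2 [inj2 pk2]] := IHn _ cS' d V.
  move=> P x y z sP cP xP yP zP xy yz.
  have tP : t \notin P by apply/negP => /(subsetP sP); rewrite !inE eqxx.
  have E u : u \in P -> (P :\ u \in V) = ((t |: P) :\ u \in U).
    move=> uP; rewrite inE; congr (_ \in U); apply/setP=> v; rewrite !inE.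
    by case: (v =P t) => //= ->; case: (t =P u) tP uP => // -> /negPf->.
  rewrite !E //; apply: (consU _ x y z) => //; try by rewrite !inE ?xP ?yP ?zP orbT.
    by rewrite subUset sub1set tS; apply/(subset_trans sP)/subsetDl.
  by rewrite cardsU1 tP cP.
have [M hM] := bounded_rank f1; have [M2 hM2] := bounded_rank f2.
pose f (K : {set 'I_N}) := if t \in K then M + f2 (K :\ t)
            else if t |: K \in U then M + M2 + f1 K else f1 K.
have sub_t (A : {set 'I_N}) : A \subset S -> t \notin A -> A \subset S :\ t.
  by move=> sA tA; rewrite subsetD1 sA tA.
have sub_t' (A : {set 'I_N}) : A \subset S -> A :\ t \subset S :\ t.
  by move=> sA; apply: setSD.
exists f; split=> [A B sA sB cA cB|L x y sL cL xL yL xy].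
  rewrite /f; have h1A := hM A; have h1B := hM B.
  have h2A := hM2 (A :\ t); have h2B := hM2 (B :\ t).
  case tA: (t \in A); case tB: (t \in B).
  - move/addnI/inj2 => e; rewrite -(setD1K tA) -(setD1K tB) e //; try exact: sub_t'.
      exact: cardD1_eq tA cA.
    exact: cardD1_eq tB cB.
  - by case: ifP => _ e; move: h1A h1B h2A h2B e; clear; lia.
  - by case: ifP => _ e; move: h1A h1B h2A h2B e; clear; lia.
  - case: ifP => _; case: ifP => _ e; try by move: h1A h1B e; clear; lia.
      by apply: inj1; rewrite ?sub_t ?tA ?tB //; move: e; clear; lia.
    by apply: inj1; rewrite ?sub_t ?tA ?tB //; move: e; clear; lia.
have ne_xy : x != y by rewrite neq_ltn xy.
have h1x := hM (L :\ x); have h1y := hM (L :\ y).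
have [tL|tL] := boolP (t \in L); last first.
  have tLD u : (t \in L :\ u) = false by rewrite inE (negPf tL) andbF.
  have ltt u : u \in L -> u < t.
    move=> uL; rewrite ltn_neqAle maxt ?(subsetP sL) // andbT.
    by rewrite -[_ == _]/(u == t); apply: contraNneq tL => <-.
  have E u : u \in L -> t |: (L :\ u) = (t |: L) :\ u.
    move=> uL; apply/setP=> v; rewrite !inE.
    by case: (v =P t) => //= ->; case: (t =P u) tL uL => // -> /negPf->.
  have Et : L = (t |: L) :\ t by rewrite setU1K.
  (* By consistency on [t |: L] no member of the packet of [L] is moved across
     the block of the sets containing [t] in the wrong direction. *)
  have := consU (t |: L) x y t _ _ _ _ _ xy (ltt _ yL).
  rewrite -Et -!E // subUset sub1set tS sL cardsU1 tL cL !inE eqxx xL yL !orbT.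
  move=> /(_ erefl erefl erefl erefl erefl).
  move=> Hc; have := pk1 _ _ _ (sub_t _ sL tL) cL xL yL xy; rewrite /f !tLD.
  move: h1x h1y Hc; clear.
  case: (L \in U); case: (t |: _ \in U); case: (t |: _ \in U) => //=;
    move=> h1x h1y Hc h; try lia; by have := Hc erefl.
have [ety|nty] := eqVneq y t.
  have tLx : t \in L :\ x by rewrite !inE tL -ety eq_sym ne_xy.
  have tLy : (t \in L :\ y) = false by rewrite ety !inE eqxx.
  rewrite /f tLx tLy ety setD1K //.
  have := hM (L :\ t); have := hM2 (L :\ x :\ t).
  move=> hx ht; case: (L \in U); last by rewrite ltn_addr.
  by apply/negbTE; rewrite -leqNgt; move: hx; clear; lia.
have ntx : x != t.
  by rewrite neq_ltn (leq_trans xy) // maxt // (subsetP sL).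
have E u : u != t -> (t \in L :\ u) * (L :\ u :\ t = L :\ t :\ u).
  by move=> nu; rewrite !inE tL eq_sym nu; split=> //; apply/setP=> v; rewrite !inE andbCA.
rewrite /f !E // ltn_add2l pk2 ?sub_t' //.
- by rewrite inE setD1K.
- exact: cardD1_eq tL cL.
- by rewrite !inE ntx xL.
- by rewrite !inE nty yL.
Qed.

Lemma packet_sorted N (r : rel {set 'I_N}) (L : {set 'I_N}) :
  (forall x y, x \in L -> y \in L -> x < y -> r (L :\ y) (L :\ x)) ->
  sorted r (packet L).
Proof.
move=> h; rewrite /packet sorted_map rev_sorted.
apply: (@sub_in_sorted _ (mem L) (fun x y : 'I_N => x < y)).
- by move=> x y xL yL xy; apply: h.
- by apply/allP=> x; rewrite mem_enum.
- exact: sorted_enum_ord.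
Qed.

Lemma sorted_packet N (r : rel {set 'I_N}) (L : {set 'I_N}) :
  (forall A B C, A \in packet L -> B \in packet L -> C \in packet L ->
     r A B -> r B C -> r A C) -> sorted r (packet L) ->
  forall x y, x \in L -> y \in L -> x < y -> r (L :\ y) (L :\ x).
Proof.
move=> tr; rewrite /packet sorted_map rev_sorted => h x y xL yL xy.
have inP u : u \in L -> L :\ u \in packet L.
  by move=> uL; apply: map_f; rewrite mem_rev mem_enum.
have so : sorted (fun x y : 'I_N => r (L :\ y) (L :\ x)) (enum L) by [].
have trin : {in mem L & &, transitive (fun x y : 'I_N => r (L :\ y) (L :\ x))}.
  by move=> u v w uL vL wL h1 h2; apply: (tr _ (L :\ u)) => //; apply: inP.
have so2 := sorted_enum_ord L.
have allL : all (mem L) (enum L) by apply/allP=> u; rewrite mem_enum.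
have ix : index x (enum L) < size (enum L) by rewrite index_mem mem_enum.
have iy : index y (enum L) < size (enum L) by rewrite index_mem mem_enum.
have := sorted_ltn_nth_in trin x allL so _ _ ix iy.
rewrite !nth_index ?mem_enum //; apply.
rewrite ltnNge; apply/negP=> le_yx.
have tr2 : transitive (fun x y : 'I_N => x < y) by move=> ? ? ?; apply: ltn_trans.
have := sorted_ltn_nth tr2 x so2 _ _ iy ix.
rewrite !nth_index ?mem_enum // => h2.
move: le_yx; rewrite leq_eqVlt => /orP[/eqP e|/h2]; last by lia.
by move: xy; rewrite -[x](@nth_index _ x x (enum L)) ?mem_enum // -e nth_index ?mem_enum // ltnn.
Qed.

Lemma card2_lt N (L : {set 'I_N}) d :
  #|L| = d.+2 -> exists x y : 'I_N, [/\ x \in L, y \in L & x < y].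
Proof.
move=> cL; have /card_gt0P[u uL] : 0 < #|L| by rewrite cL.
have /card_gt0P[v] : 0 < #|L :\ u| by rewrite (cardD1_eq uL cL).
rewrite !inE => /andP[nvu vL].
have [uv|vu|e] := ltngtP u v; [by exists u, v | by exists v, u |].
by rewrite (val_inj e) eqxx in nvu.
Qed.

(** The existence half of Ziegler's theorem, from the order given by the ranks. *)
Lemma consistent_inversions N d (U : {set {set 'I_N}}) :
  0 < d -> U \subset dsubs N d.+1 -> consistent setT d U ->
  exists R : adm_order N d, inversions R = U.
Proof.
move=> d0 sU consU; have [f [injf pk]] := consistent_rank consU.
pose R : {set {set 'I_N} * {set 'I_N}} :=
  [set p in setX (dsubs N d) (dsubs N d) | f p.1 < f p.2].
have E A B : precs R A B = [&& A \in dsubs N d, B \in dsubs N d & f A < f B].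
  by rewrite /precs inE in_setX /= andbA.
have lex (L : {set 'I_N}) : L \in dsubs N d.+1 -> L \notin U -> lexicographic R L.
  rewrite inE => /eqP cL nL; apply: packet_sorted => x y xL yL xy.
  by rewrite E !inE (cardD1_eq xL cL) (cardD1_eq yL cL) eqxx pk.
have anti (L : {set 'I_N}) : L \in dsubs N d.+1 -> L \in U -> antilexicographic R L.
  rewrite inE => /eqP cL nL; apply: packet_sorted => x y xL yL xy.
  rewrite E !inE (cardD1_eq xL cL) (cardD1_eq yL cL) eqxx /=.
  have := pk L x y (subsetT _) cL xL yL xy; rewrite nL /= => /negbT.
  rewrite -leqNgt leq_eqVlt => /orP[/eqP e|//].
  have := @injf (L :\ x) (L :\ y) (subsetT _) (subsetT _) (cardD1_eq xL cL) (cardD1_eq yL cL) e.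
  by move/(setD1_inj xL) => exy; rewrite exy ltnn in xy.
have admR : admissible d R.
  apply/andP; split.
    apply/and4P; split.
    - by apply/subsetP=> p; rewrite inE => /andP[].
    - by apply/forall_inP=> A _; rewrite E ltnn !andbF.
    - apply/forall_inP=> A _; apply/forall_inP=> B _; apply/forall_inP=> C _.
      rewrite !E; apply/implyP=> /and3P[-> _ AB].
      by apply/implyP=> /and3P[_ -> BC]; rewrite (ltn_trans AB BC).
    - apply/forall_inP=> A AD; apply/forall_inP=> B BD; apply/implyP.
      rewrite !E AD BD /= -neq_ltn; apply: contraNneq => e.
      by move: AD BD; rewrite !inE => /eqP cA /eqP cB; apply/eqP/injf.
  apply/forall_inP=> L LD; have [LU|LU] := boolP (L \in U).
    by rewrite anti // orbT.
  by rewrite lex.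
exists (AdmOrder admR); apply/setP=> L; rewrite inE /=.
have [LU|LU] := boolP (L \in U); first by rewrite anti ?(subsetP sU).
apply/negP=> /andP[LD aL]; have := lex _ LD LU => lL.
move: (LD); rewrite inE => /eqP cL.
(* Packets have at least two members as [0 < d], so they cannot be ordered in
   both ways. *)
case: (d) d0 cL => // d' _ cL.
have [x [y [xL yL xy]]] := card2_lt cL.
have tr A B C : precs R A B -> precs R B C -> precs R A C.
  by rewrite !E => /and3P[-> _ AB] /and3P[_ -> BC]; rewrite (ltn_trans AB BC).
have := @sorted_packet _ _ L _ lL x y xL yL xy.
have := @sorted_packet _ _ L _ aL x y xL yL xy.
rewrite !E => /(_ _)/and3P[|_ _ yx]; first by move=> A B C _ _ _ h1 h2; apply: tr h2 h1.
move=> /(_ _)/and3P[|_ _ xy']; first by move=> A B C _ _ _; apply: tr.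
by have := ltn_trans yx xy'; rewrite ltnn.
Qed.

(** The converse half: the pattern in-out-in over [x < y < z] would order
    [P :\ x :\ y], [P :\ x :\ z] and [P :\ y :\ z] cyclically, and so would
    out-in-out. *)
Lemma inversions_consistent N d (R : adm_order N d) :
  0 < d -> consistent setT d (inversions R).
Proof.
move=> d0 P x y z _ cP xP yP zP xy yz.
have /andP[/and4P[sR irr tr tot]] := adm_relP R.
set r := adm_rel R in sR irr tr tot *.
have {}irr (A : {set 'I_N}) : A \in dsubs N d -> ~~ precs r A A.
  by move=> AD; have /forall_inP/(_ _ AD) := irr.
have {}tr A B C : precs r A B -> precs r B C -> precs r A C.
  move=> AB BC; have := subsetP sR _ AB; have := subsetP sR _ BC.
  rewrite !in_setX /= => /andP[_ CD] /andP[AD BD].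
  by have /forall_inP/(_ _ AD)/forall_inP/(_ _ BD)/forall_inP/(_ _ CD)/implyP/(_ AB)/implyP := tr; apply.
move/forall_inP => adm.
have xz := ltn_trans xy yz.
have D u : u \in P -> P :\ u \in dsubs N d.+1.
  by move=> uP; rewrite inE (cardD1_eq uP cP).
have lx u a b : u \in P -> a \in P -> b \in P -> u != a -> u != b -> a < b ->
    P :\ u \notin inversions R -> precs r (P :\ u :\ b) (P :\ u :\ a).
  move=> uP aP bP ua ub ab; have := adm _ (D u uP); rewrite inE D //= => /orP[lu|->//] _.
  apply: (sorted_packet _ lu) => //; try by rewrite !inE eq_sym ?ua ?ub.
  by move=> A B C _ _ _; apply: tr.
have ax u a b : u \in P -> a \in P -> b \in P -> u != a -> u != b -> a < b ->
    P :\ u \in inversions R -> precs r (P :\ u :\ a) (P :\ u :\ b).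
  move=> uP aP bP ua ub ab; rewrite inE => /andP[_ lu].
  apply: (sorted_packet _ lu) => //; try by rewrite !inE eq_sym ?ua ?ub.
  by move=> A B C _ _ _ h1 h2; apply: tr h2 h1.
have sw a b : P :\ a :\ b = P :\ b :\ a by apply/setP=> v; rewrite !inE andbCA.
have nxy : x != y by rewrite neq_ltn xy.
have nyz : y != z by rewrite neq_ltn yz.
have nxz : x != z by rewrite neq_ltn xz.
have [nyx nzy nzx] : [/\ y != x, z != y & z != x] by split; rewrite eq_sym.
have Dxy : P :\ x :\ y \in dsubs N d.
  by rewrite inE (@cardD1_eq _ _ y d) ?inE ?nyx ?yP // (cardD1_eq xP cP).
have noloop := negP (irr _ Dxy).
case: (boolP (P :\ z \in _)) => iz ix; rewrite ix.
  apply: contraT => iy; case: noloop.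
  apply: (tr _ _ _ (ax x y z xP yP zP nxy nxz yz ix)).
  rewrite (sw x z); apply: (tr _ _ _ (ax z x y zP xP yP nzx nzy xy iz)).
  by rewrite (sw z y) (sw x y); apply: lx.
apply: contraTF isT => iy; case: noloop.
rewrite {1}(sw x y); apply: (tr _ _ _ (ax y x z yP xP zP nyx nyz xz iy)).
rewrite (sw y z); apply: (tr _ _ _ (lx z x y zP xP yP nzx nzy xy iz)).
by rewrite (sw z x); apply: lx => //; rewrite ix.
Qed.

(** * Subsets as increasing sequences *)

(** An [r]-subset of ['I_N] is handled as the strictly increasing sequence
    [f 0 < ... < f r.-1] of its elements; the values of [f] beyond [r] are
    arbitrary. Removing the element of index [k] is composition with
    [bump k]. *)
Definition incr r (f : nat -> nat) := forall i k, i < k -> k < r -> f i < f k.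

Definition below r N (f : nat -> nat) := forall i, i < r -> f i < N.

Definition im N r (f : nat -> nat) : {set 'I_N} :=
  [set x : 'I_N | has (fun i => f i == x) (iota 0 r)].

Lemma imP N r (f : nat -> nat) (x : 'I_N) :
  reflect (exists2 i : nat, i < r & f i = x) (x \in im N r f).
Proof.
rewrite inE; apply: (iffP hasP) => -[i].
  by rewrite mem_iota => /andP[_ h] /eqP e; exists i.
by move=> h e; exists i; rewrite ?mem_iota ?e ?eqxx.
Qed.

Lemma eq_im N r (f g : nat -> nat) : (forall i, i < r -> f i = g i) -> im N r f = im N r g.
Proof.
move=> h; apply/setP=> x; apply/imP/imP => -[i ir e]; exists i => //; last by rewrite h.
by rewrite -h.
Qed.

Lemma incr_gap r f i k : incr r f -> i <= k -> k < r -> f i + (k - i) <= f k.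
Proof.
move=> inc; elim: k => [|k IHk] ik kr; first by have -> : i = 0; lia.
have [->|nik] := eqVneq i k.+1; first by lia.
have h := inc k k.+1 (ltnSn k) kr; have := IHk; lia.
Qed.

Lemma incr_le r f i k : incr r f -> i <= k -> k < r -> f i <= f k.
Proof. by move=> inc ik kr; have := incr_gap inc ik kr; lia. Qed.

Lemma card_im N r f : incr r f -> below r N f -> #|im N r f| = r.
Proof.
move=> inc bnd.
pose g (i : 'I_r) : 'I_N := Ordinal (bnd i (ltn_ord i)).
have injg : injective g.
  move=> i k /(congr1 val) /= e; apply: val_inj; have [ik|ki|//] := ltngtP i k.
    by have := inc _ _ ik (ltn_ord k); rewrite e ltnn.
  by have := inc _ _ ki (ltn_ord i); rewrite e ltnn.
have -> : im N r f = g @: [set: 'I_r].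
  apply/setP=> x; apply/imP/imsetP => [[i lt_ir e]|[i _ ->]]; last by exists i.
  by exists (Ordinal lt_ir) => //; apply: val_inj.
by rewrite card_imset // cardsT card_ord.
Qed.

Lemma im_surj N r (L : {set 'I_N}) : #|L| = r ->
  exists f, [/\ incr r f, below r N f & L = im N r f].
Proof.
move=> cL; pose s := map val (enum L); pose f i := nth 0 s i.
have sz : size s = r by rewrite size_map -cardE.
have so : sorted ltn s by rewrite sorted_map; apply: sorted_enum_ord.
exists f; split.
- by move=> i k ik kr; apply: (sorted_ltn_nth ltn_trans) => //; rewrite inE sz; lia.
- move=> i ir; have : f i \in s by rewrite mem_nth ?sz.
  by case/mapP=> x _ ->; apply: ltn_ord.
apply/setP=> x; apply/idP/imP => [xL|[i ir e]].
  have xs : val x \in s by rewrite map_f ?mem_enum.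
  by exists (index (val x) s); [rewrite -sz index_mem | rewrite /f nth_index].
have : nat_of_ord x \in s by rewrite -e mem_nth ?sz.
by case/mapP=> y; rewrite mem_enum => yL /val_inj->.
Qed.

Lemma incr_face r f k : incr r.+1 f -> incr r (f \o bump k).
Proof. by move=> inc i l il lr /=; apply: inc; rewrite /bump; lia. Qed.

Lemma below_face r N f k : below r.+1 N f -> below r N (f \o bump k).
Proof. by move=> b i ir /=; apply: b; rewrite /bump; lia. Qed.

Lemma incr_inj r f i k : incr r f -> i < r -> k < r -> f i = f k -> i = k.
Proof.
move=> inc ir kr e; have [ik|ki|//] := ltngtP i k.
  by have := inc _ _ ik kr; lia.
by have := inc _ _ ki ir; lia.
Qed.

Lemma im_face N r f k (x : 'I_N) : incr r.+1 f -> k < r.+1 -> f k = x ->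
  im N r.+1 f :\ x = im N r (f \o bump k).
Proof.
move=> inc kr ek; apply/setP=> y; rewrite in_setD1.
apply/andP/imP => [[nyx /imP[i ir ei]]|[i ir /= ei]].
  have nik : i != k by apply: contraNneq nyx => e; apply/eqP/val_inj; rewrite /= -ek -ei e.
  by exists (unbump k i); rewrite /= ?unbumpK ?inE // /unbump; lia.
have br : bump k i < r.+1 by rewrite /bump; lia.
split; last by apply/imP; exists (bump k i).
apply/eqP=> e; have := incr_inj inc br kr; rewrite ei ek e => /(_ erefl).
by move/eqP; rewrite eq_sym (negPf (neq_bump _ _)).
Qed.

Definition consistent_seq N d (U : {set {set 'I_N}}) :=
  forall f a b c, incr d.+2 f -> below d.+2 N f -> a < b -> b < c -> c < d.+2 ->
  (im N d.+1 (f \o bump a) \in U) = (im N d.+1 (f \o bump c) \in U) ->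
  (im N d.+1 (f \o bump b) \in U) = (im N d.+1 (f \o bump a) \in U).

Lemma consistentP N d (U : {set {set 'I_N}}) :
  consistent setT d U <-> consistent_seq d U.
Proof.
split=> [h f a b c inc bnd ab bc cd|h P x y z _ cP xP yP zP xy yz].
  have bd := ltn_trans bc cd; have ad := ltn_trans ab bd.
  have F k (kd : k < d.+2) := im_face (x := Ordinal (bnd k kd)) inc kd erefl.
  rewrite -!F; apply: h; rewrite ?subsetT ?card_im //=; try by apply/imP; eexists; last reflexivity.
    exact: inc.
  exact: inc.
have [f [inc bnd eP]] := im_surj cP; rewrite eP in xP yP zP *.
have /imP[a ad ea] := xP; have /imP[b bd eb] := yP; have /imP[c cd ec] := zP.
rewrite (im_face inc ad ea) (im_face inc bd eb) (im_face inc cd ec); apply: h => //.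
  by rewrite ltnNge; apply/negP => /(incr_le inc)/(_ ad); lia.
by rewrite ltnNge; apply/negP => /(incr_le inc)/(_ bd); lia.
Qed.

(** * Insertion of one order into another *)

(** The reduction [L |-> phi^-1 (Lbar L)] on increasing sequences, where [e] is
    the number of elements of [L] smaller than [j + m]. The elements beyond
    [j + m] are translated; if [s] elements lie in the block, then the
    [i]-th element of the block is replaced by its minimum with the [i]-th
    of the [s] largest elements of the nucleus. *)
Definition collapse d j m e (f : nat -> nat) i :=
  if i < e then minn (f i) (j + d + i - e) else f i - (m - d).

Definition low r b (f : nat -> nat) := count (fun i => f i < b) (iota 0 r).

Lemma low_le r b f : low r b f <= r.
Proof. by rewrite -[leqRHS](size_iota 0); apply: count_size. Qed.

Lemma low_eq r b e f :
  e <= r -> (forall i, i < r -> (f i < b) = (i < e)) -> low r b f = e.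
Proof.
move=> er h; rewrite /low; have -> : r = e + (r - e) by lia.
rewrite iotaD count_cat add0n.
have -> : count (fun i => f i < b) (iota 0 e) = e.
  rewrite -[RHS](size_iota 0); apply/eqP; rewrite -all_count; apply/allP=> i.
  by rewrite mem_iota => hi; rewrite h; lia.
rewrite (@eq_in_count _ _ pred0) ?count_pred0 ?addn0 // => i.
by rewrite mem_iota => hi; rewrite h /=; [apply/negbTE|]; lia.
Qed.

Lemma low_incr r b f i : incr r f -> i < r -> (f i < b) = (i < low r b f).
Proof.
move=> inc ir.
suff [e er h] : exists2 e, e <= r & forall i, i < r -> (f i < b) = (i < e).
  by rewrite (low_eq er h) h.
elim: r inc {ir} => [|r IHr] inc; first by exists 0.
have [|e er h] := IHr; first by move=> ? ? ? ?; apply: inc; lia.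
have [fr|fr] := ltnP (f r) b.
  exists r.+1 => // k; rewrite ltnS => kr; have := incr_le inc kr (ltnSn r); lia.
exists e => [|k]; first by lia.
rewrite ltnS leq_eqVlt => /orP[/eqP->|/h//].
by rewrite ltnNge fr ltnNge er.
Qed.

(** If [e] elements of an increasing [f] are smaller than the right end of the
    block, then the last [d+1] of them do not all lie in the block, so that its
    nucleus has room for all elements in it. *)
Definition small_block d j e (f : nat -> nat) :=
  forall i, i + d < e -> f i < j.

(** This excludes that the subtraction in [collapse] is truncated. *)
Lemma small_block_bound d j r e f :
  incr r f -> e <= r -> small_block d j e f -> e <= j + d.
Proof.
move=> inc er nb; have [//|ed] := leqP e (j + d).
have h := nb (e - d.+1); have := @incr_gap r f 0 (e - d.+1) inc; lia.
Qed.

Lemma collapse_incr d j m r e f : d <= m ->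
  incr r f -> e <= r -> (forall i, i < r -> (f i < j + m) = (i < e)) ->
  small_block d j e f -> incr r (collapse d j m e f).
Proof.
move=> dm inc er he nb i k ik kr; have eb := small_block_bound inc er nb.
have fik := inc _ _ ik kr; have hi := he i (ltn_trans ik kr); have hk := he k kr.
rewrite /collapse; case: (ltnP i e) hi => ie hi; case: (ltnP k e) hk => ke hk; lia.
Qed.

Lemma collapse_below n d j m r e f : d <= m -> j + d <= n -> e <= j + d ->
  (forall i, i < r -> (f i < j + m) = (i < e)) ->
  below r (n + m - d) f -> below r n (collapse d j m e f).
Proof.
move=> dm jn eb he bnd i ir; have bi := bnd _ ir; have hi := he _ ir.
by rewrite /collapse; case: (ltnP i e) hi => ie hi; lia.
Qed.

Lemma mem_take_rev_enum N (T : {set 'I_N}) (x : 'I_N) q : x \in T ->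
  #|[set y in T | x < y]| < q -> x \in take q (rev (enum T)).
Proof.
move=> xT lq; set s := rev (enum T).
have xs : x \in s by rewrite mem_rev mem_enum.
have so : sorted (fun y z : 'I_N => z < y) s by rewrite rev_sorted; apply: sorted_enum_ord.
have us : uniq s by rewrite rev_uniq enum_uniq.
rewrite in_take //; apply: leq_ltn_trans lq.
have ix : index x s <= size s by rewrite index_size.
rewrite -[leqLHS](size_takel ix) -(card_uniqP (take_uniq _ us)).
apply/subset_leq_card/subsetP=> y yt; rewrite inE.
have ys := mem_take yt; move: (ys); rewrite mem_rev mem_enum => -> /=.
have iy : index y s < index x s by rewrite -in_take.
have tr : transitive (fun y z : 'I_N => z < y) by move=> a b c h1 h2; apply: ltn_trans h2 h1.
have := sorted_ltn_nth tr x so _ _ _ _ iy.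
by rewrite !nth_index // !inE !index_mem; apply.
Qed.

Section Reduction.
Variables (d n m j : nat).
Hypotheses (dm : d <= m) (jn : j + d <= n).
Local Notation N := (n + m - d).

Lemma phi_ltN (i : 'I_n) : phi d m j i < N.
Proof. by rewrite /phi; case: ifP => h; have := ltn_ord i; lia. Qed.

Lemma card_phi_inv (L : {set 'I_N}) : #|phi_inv j L| <= #|L|.
Proof.
pose g i := Ordinal (phi_ltN i).
have injg : injective g.
  move=> i k /(congr1 val) /=; rewrite /phi => e; apply: val_inj => /=.
  by move: e; case: ifP => hi; case: ifP => hk e; lia.
rewrite -(card_imset _ injg); apply/subset_leq_card/subsetP=> x /imsetP[i].
rewrite inE => /exists_inP[y yL /eqP e] ->.
by have -> : g i = y by apply: val_inj.
Qed.

Lemma card_Lbar (L : {set 'I_N}) : #|Lbar j L| <= #|L|.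
Proof.
rewrite /Lbar; apply: leq_trans (leq_card_setU _ _) _.
have -> : #|L| = #|Lplus j L| + #|Lminus j L|.
  rewrite -cardsUI; have -> : Lplus j L :&: Lminus j L = set0.
    apply/setP=> x; rewrite !inE; case: (x \in L) => //=.
    apply/negP; lia.
  rewrite cards0 addn0; congr #|pred_of_set _|; apply/setP=> x; rewrite !inE.
  by case: (x \in L) => //=; lia.
rewrite leq_add2l cardsE; apply: leq_trans (card_size _) _.
by rewrite size_take; case: ltnP.
Qed.

Variable f : nat -> nat.
Hypotheses (inc : incr d.+1 f) (bnd : below d.+1 N f).
Local Notation e := (low d.+1 (j + m) f).

Lemma below_block i : i < d.+1 -> (f i < j + m) = (i < e).
Proof. exact: low_incr. Qed.

(** For an element of the block that exceeds its bound [x := j + d + i - e],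
    the number of free places of the nucleus to the right of [x] is smaller
    than the number of elements outside the nucleus, so that one of these is
    moved to [x] unless [x] is already present. *)
Lemma Lbar_collapse : small_block d j e f ->
  phi_inv j (Lbar j (im N d.+1 f)) = im n d.+1 (collapse d j m e f).
Proof.
move=> nb; set L := im N d.+1 f.
have er : e <= d.+1 by apply: low_le.
have eb := small_block_bound inc er nb.
have ci := collapse_incr dm inc er below_block nb.
have cb := collapse_below dm jn eb below_block bnd.
(* Neither [phi_inv] nor [Lbar] increases the number of elements, so it is enough
   to find the elements of [collapse f] in the reduction of [L]. *)
apply/esym/eqP; rewrite eqEcard card_im // (leq_trans (card_phi_inv _)) ?andbT; last first.
  by rewrite (leq_trans (card_Lbar _)) // card_im.
apply/subsetP=> y /imP[i ir ey]; rewrite inE; apply/exists_inP.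
exists (Ordinal (phi_ltN y)); last by [].
have fin k : k < d.+1 -> forall z : 'I_N, f k = z -> z \in L.
  by move=> kr z ez; apply/imP; exists k.
clearbody L; have hi := below_block ir.
rewrite !inE; have [old|new] := eqVneq (f i) (phi d m j y).
  apply/orP; left; rewrite (fin i) //=.
  by move: old ey; rewrite /collapse /phi; case: (ltnP i e) hi; case: (ltnP y (j + d)); lia.
have {new} [ie xle ex] : [/\ i < e, j + d + i - e < f i & y = j + d + i - e :> nat].
  move: new ey; rewrite /collapse /phi; case: (ltnP i e) hi; case: (ltnP y (j + d));
    by move=> *; split; lia.
have px : phi d m j y = j + d + i - e by rewrite /phi ex; case: ltnP; lia.
set x := Ordinal (phi_ltN y).
have vx : x = j + d + i - e :> nat by [].
have jx : j <= x.
  rewrite vx; case: (leqP e (d + i)) => [|h]; first by lia.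
  have := nb i; lia.
have [xL|xL] := boolP (x \in L); first by rewrite /= px; apply/orP; left; lia.
apply/orP; right; apply: mem_take_rev_enum.
  by rewrite !inE (negPf xL) /= px; lia.
(* [G]: the places of the nucleus to the right of [x]; [H]: the elements of
   the block with index at least [i], which all exceed [x]. *)
pose G := im N (e - i.+1) (fun k => x.+1 + k).
pose H := im N (e - i) (fun k => f (i + k)).
have cG : #|G| <= e - i.+1.
  rewrite card_im //; first by move=> a b ab _; lia.
  move=> k kr; have := ltn_ord x; lia.
have cH : #|H| = e - i.
  apply: card_im => [a b ab br|k kr]; first by apply: inc; lia.
  by apply: bnd; lia.
set T := [set y0 in _ | _].
have cT : #|T| + #|L :&: G| <= #|G|.
  have -> : #|G| = #|G :&: L| + #|G :\: L| by rewrite cardsID.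
  rewrite addnC setIC leq_add2l; apply/subset_leq_card/subsetP=> z.
  rewrite !inE => /andP[/andP[hz1 hz2] xz]; apply/andP; split.
    by move: hz1; rewrite hz2 orbT /= andbT.
  apply/hasP; exists (z - x.+1); last by apply/eqP; lia.
  by rewrite mem_iota; lia.
have cL : #|H| <= #|Lminus j L| + #|L :&: G|.
  apply: leq_trans (leq_card_setU _ _); apply/subset_leq_card/subsetP=> z /imP[k kr ez].
  have zL : z \in L by apply: (fin (i + k)) => //; lia.
  have fik : f i <= f (i + k) by apply: (incr_le inc); lia.
  have hk := below_block (i := i + k); rewrite !inE zL /=.
  have [zd|zd] := ltnP z (j + d); last by apply/orP; left; lia.
  apply/orP; right; apply/hasP; exists (z - x.+1); last by apply/eqP; lia.
  by rewrite mem_iota; lia.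
lia.
Qed.

Lemma mem_insertion_set I J :
  (im N d.+1 f \in insertion_set d j I J) =
  if (j <= f 0) && (f d < j + m) then im m d.+1 (fun i => f i - j) \in J
  else im n d.+1 (collapse d j m e f) \in I.
Proof.
set L := im N d.+1 f; rewrite inE [L \in _]inE card_im // eqxx /=.
have -> : (L \subset secB d n m j) = (j <= f 0) && (f d < j + m).
  apply/subsetP/andP => [h|[h1 h2] x /imP[i ir ex]].
    have d0 := ltn0Sn d; have dd := ltnSn d.
    have /h : Ordinal (bnd d0) \in L by apply/imP; exists 0.
    have /h : Ordinal (bnd dd) \in L by apply/imP; exists d.
    by rewrite !inE /= => /andP[_ ->] /andP[->].
  rewrite inE -ex; have := @incr_le _ f 0 i inc; have := @incr_le _ f i d inc; lia.
case: ifP => [/andP[h1 h2]|nB].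
  congr (_ \in J); apply/setP=> x; rewrite inE; apply/exists_inP/imP.
    by case=> y /imP[i ir ey] /eqP e; exists i => //; lia.
  case=> i ir ex; exists (Ordinal (bnd ir)); first by apply/imP; exists i.
  by apply/eqP => /=; have := @incr_le _ f 0 i inc; lia.
have nb : small_block d j e f.
  move=> i ie; have er : e <= d.+1 by apply: low_le.
  have := below_block (ltnSn d); move/negbT: nB; have -> : i = 0 by lia.
  by rewrite negb_and -ltnNge -leqNgt => /orP[//|]; lia.
(* If [L] avoids the block outside the nucleus, then [Lbar L = L]. *)
case: ifP => [sL|_]; last by rewrite Lbar_collapse.
rewrite -Lbar_collapse //; congr (@phi_inv _ _ _ _ _ \in I).
have LE : Lplus j L = L by apply/setIidPl.
rewrite /Lbar LE; have -> : Lminus j L = set0.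
  apply/setP=> x; rewrite in_setI in_set0; apply/negP=> /andP[xL].
  by have := subsetP sL _ xL; rewrite !inE; lia.
by rewrite cards0 take0; apply/setP=> x; rewrite in_setU [X in _ || X]inE orbF.
Qed.

End Reduction.

Lemma low_face r b f k : incr r.+1 f -> k < r.+1 ->
  low r b (f \o bump k) = low r.+1 b f - (k < low r.+1 b f).
Proof.
move=> inc kr; have er := low_le r.+1 b f.
have he i (ir : i < r.+1) := low_incr b inc ir.
set e := low _ _ _ in er he *; apply: low_eq => [|i ir /=].
  by case: (ltnP k e) => /=; lia.
rewrite he; rewrite /bump; case: (leqP k i) => ki; case: (ltnP k e) => ke /=; lia.
Qed.

(** Where the bound starts to be active in [collapse]: the difference of the
    two sides of the comparison is monotone in [i]. *)
Lemma collapse_threshold r E c (f : nat -> nat) : incr r f -> E <= r ->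
  exists i0, [/\ i0 <= E, forall i, i < i0 -> f i <= c + i &
                  forall i, i0 <= i -> i < E -> c + i < f i].
Proof.
move=> inc; elim: E => [|E IHE] er; first by exists 0; split=> // i; lia.
have [i0 [h0 h1 h2]] := IHE (ltnW er).
have [hE|hE] := leqP (f E) (c + E).
  exists E.+1; split=> // i; last by lia.
  by move=> iE; have := @incr_gap _ _ i E inc; lia.
exists i0; split=> [|//|i i0i]; first by lia.
by rewrite ltnS leq_eqVlt => /orP[/eqP->//|]; apply: h2.
Qed.

(** Deleting one element commutes with [collapse] up to the index of the
    deleted element: once the bound is active all elements of the block are
    replaced by consecutive ones, and deleting any of those amounts to deleting
    the first of them. *)
Lemma collapse_face d j m f i0 k :
  incr d.+2 f -> d <= m -> k < d.+2 ->
  let E := low d.+2 (j + m) f in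
  small_block d j E f -> i0 <= E ->
  (forall i, i < i0 -> f i <= j + d - E + i) ->
  (forall i, i0 <= i -> i < E -> j + d - E + i < f i) ->
  forall i, i < d.+1 ->
  collapse d j m (low d.+1 (j + m) (f \o bump k)) (f \o bump k) i =
  (collapse d j m E f \o bump (if k < E then minn k i0 else k)) i.
Proof.
move=> inc dm kd E nb i0E h1 h2 i ir; rewrite low_face // -/E.
have Ed : E <= d.+2 by apply: low_le.
have Eb := small_block_bound inc Ed nb.
have he l (lr : l < d.+2) : (f l < j + m) = (l < E) := low_incr _ inc lr.
clearbody E; rewrite /collapse /= /bump.
have g1 := h1 i; have g2 := h2 i; have g1' := h1 i.+1; have g2' := h2 i.+1.
have f1 := inc i i.+1 (ltnSn i) ir.
case: (ltnP k E) => kE /=; case: (leqP k i) => ki /=; rewrite ?add0n ?add1n ?subn0.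
- have -> : (minn k i0 <= i) = true by lia.
  have -> : (true + i < E) = (i < E - 1) by apply/idP/idP; lia.
  by rewrite add1n; case: ifP => h; lia.
- have -> : i < E - 1 by lia.
  have [h|h] := leqP i0 i.
    have -> : (minn k i0 <= i) = true by lia.
    have -> : true + i < E by lia.
    by rewrite add1n; have := g2 h; have := g2'; lia.
  have -> : (minn k i0 <= i) = false by lia.
  have -> : false + i < E by lia.
  by rewrite add0n; have := g1 h; lia.
- have -> : (i < E) = false by lia.
  by have -> : (i.+1 < E) = false by lia.
- by [].
Qed.

Section InsertionConsistent.
Variables (d n m j : nat) (I : {set {set 'I_n}}) (J : {set {set 'I_m}}).
Hypotheses (dm : d <= m) (jn : j + d <= n).
Hypotheses (consI : consistent_seq d I) (consJ : consistent_seq d J).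
Local Notation N := (n + m - d).

(** Let [P] be a [(d+2)]-set. If at most [d] of its elements lie in the block,
    then its packet is mapped monotonically to the packet of its reduction. If
    exactly one element lies outside the block, then it is the first or the last
    one, and the other [d+1] members of the packet have equal reductions. *)
Lemma insertion_consistent : consistent_seq d (insertion_set d j I J).
Proof.
move=> f a b c inc bnd ab bc cd; have bd := ltn_trans bc cd; have ad := ltn_trans ab bd.
have mem k (kd : k < d.+2) := mem_insertion_set dm jn (@incr_face _ _ k inc) (@below_face _ _ _ k bnd) I J.
pose E := low d.+2 (j + m) f.
have Ed : E <= d.+2 by apply: low_le.
have he l (lr : l < d.+2) : (f l < j + m) = (l < E) := low_incr _ inc lr.
have hlow k (kd : k < d.+2) := low_face (j + m) inc kd; rewrite -/E in hlow.
have small : small_block d j E f ->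
  (im N d.+1 (f \o bump a) \in insertion_set d j I J) =
  (im N d.+1 (f \o bump c) \in insertion_set d j I J) ->
  (im N d.+1 (f \o bump b) \in insertion_set d j I J) =
  (im N d.+1 (f \o bump a) \in insertion_set d j I J).
  move=> nb; have Eb := small_block_bound inc Ed nb.
  have [i0 [i0E h1 h2]] := collapse_threshold (j + d - E) inc Ed.
  pose g k := if k < E then minn k i0 else k.
  pose h := collapse d j m E f.
  have F k : k < d.+2 -> (im N d.+1 (f \o bump k) \in insertion_set d j I J) =
      (im n d.+1 (h \o bump (g k)) \in I).
    move=> kd; rewrite mem // (eq_im _ (collapse_face inc dm kd nb i0E h1 h2)).
    case: ifP => // /andP[/= b0 b1]; case: (posnP k) => [k0|k0].
      move: b0 b1; rewrite k0 /bump /= !add1n he // => b0 b1.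
      by have := nb 1 b1; lia.
    have [k1|k1] := leqP k d.
      move: b0 b1; rewrite /bump k1 (leqNgt k 0) k0 /= add0n add1n he // => b0 b1.
      by have := nb 0; lia.
    move: b0 b1; rewrite /bump (leqNgt k d) k1 (leqNgt k 0) k0 /= !add0n (he d) ?leqnSn // => b0 b1.
    by have := nb 0 b1; lia.
  have hc : incr d.+2 h by apply: collapse_incr.
  have hb : below d.+2 n h by apply: collapse_below.
  rewrite !F //.
  have [gab|gab] := leqP (g b) (g a).
    by have -> : g b = g a by rewrite /g in gab *; move: gab; do 2!case: ifP; lia.
  have [gbc|gbc] := leqP (g c) (g b).
    have -> : g c = g b by rewrite /g in gbc *; move: gbc; do 2!case: ifP; lia.
    by [].
  by apply: consI => //; rewrite /g; case: ifP; lia.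
have [h0|h0] := leqP j (f 0); have [h1|h1] := ltnP (f d.+1) (j + m).
(* All elements lie in the block. *)
- pose g i := f i - j.
  have incg : incr d.+2 g.
    move=> i k ik kr; have := inc _ _ ik kr; have := @incr_le _ f 0 i inc; rewrite /g; lia.
  have bndg : below d.+2 m g.
    move=> i ir; have := @incr_le _ f i d.+1 inc; rewrite /g; lia.
  have F k (kd : k < d.+2) : (im N d.+1 (f \o bump k) \in insertion_set d j I J) =
      (im m d.+1 (g \o bump k) \in J).
    rewrite mem //; case: ifP => // /negP[] /=.
    by have := @incr_le _ f 0 (bump k 0) inc; have := @incr_le _ f (bump k d) d.+1 inc;
      rewrite /bump; lia.
  by rewrite !F //; apply: consJ.
(* Exactly the last element is to the right of the block. *)
- have [Ed1|Ed1] := ltnP d E; last by apply: small => i; lia.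
  pose g i := if i < d then j + i else f i.+1 - (m - d).
  have F k (kd : k < d.+1) : (im N d.+1 (f \o bump k) \in insertion_set d j I J) =
      (im n d.+1 g \in I).
    have Ee : E = d.+1 by have := he d.+1; lia.
    have kd2 : k < d.+2 by apply: ltnW.
    rewrite (mem k kd2) (hlow k kd2) Ee kd subn1 /=; case: ifP => [/andP[_]|_].
      by rewrite /bump (kd : k <= d) add1n; lia.
    congr (_ \in I); apply: eq_im => i ir; rewrite /collapse /g /= /bump.
    have [id|id] := ltnP i d; last by have -> : (k <= i) = true by lia.
    by have := @incr_gap _ f 0 ((k <= i) + i) inc; case: (k <= i) => /=; lia.
  by rewrite (F a) ?(F b) //; lia.
(* Exactly the first element is to the left of the block. *)
- have [h2|h2] := leqP j (f 1); last first.
    by apply: small => i iE; have : i = 0 \/ i = 1; [lia | case=> ->].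
  pose g i := if i is i'.+1 then j + i' else f 0.
  have Ee : E = d.+2 by have := he d.+1; lia.
  have F k (kd : k < d.+2) : 0 < k -> (im N d.+1 (f \o bump k) \in insertion_set d j I J) =
      (im n d.+1 g \in I).
    move=> k0; rewrite mem // hlow // Ee kd subn1 /=; case: ifP => [/andP[]|_].
      by rewrite /bump (leqNgt k 0) k0 /= add0n; lia.
    congr (_ \in I); apply: eq_im => i ir; rewrite /collapse /g /= /bump ir.
    case: i ir => [|i] ir; first by rewrite (leqNgt k 0) k0 /= add0n; lia.
    by have := @incr_gap _ f 1 ((k <= i.+1) + i.+1) inc; case: (k <= i.+1) => /=; lia.
  by rewrite (F b) ?(F c) ?(leq_ltn_trans _ ab) ?(ltn_trans _ bc) //; lia.
by apply: small => i; have := he d.+1 (ltnSn _); case: i => [|i] //; lia.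
Qed.
End InsertionConsistent.

Lemma Inv_sub N d (b : bruhat N d) : Inv b \subset dsubs N d.+1.
Proof. by apply/subsetP=> L; rewrite inE => /andP[]. Qed.

Lemma Inv_consistent N d (b : bruhat N d) : 0 < d -> consistent_seq d (Inv b).
Proof. by move=> d0; apply/consistentP/inversions_consistent. Qed.

Theorem Inv_insertion d : 0 < d -> insertion_well_defined d.
Proof.
move=> d0 n m j b b' dn dm jn; rewrite /insertion.
case: pickP => [R /eqP e|none]; first by rewrite Inv_pi.
have [||R e] := @consistent_inversions (n + m - d) d (insertion_set d j (Inv b) (Inv b')) d0.
- by apply/subsetP=> L; rewrite inE => /andP[].
- apply/consistentP/insertion_consistent => //; [lia | exact: Inv_consistent..].
- by have := none R; rewrite e eqxx.
Qed.

(** * Sequential and parallel associativity of insertion *)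

Definition inv d (x : bruhats d) (f : nat -> nat) : bool :=
  im (projT1 x) d.+1 f \in Inv (projT2 x).

Lemma eq_inv d (x : bruhats d) f g :
  (forall i, i < d.+1 -> f i = g i) -> inv x f = inv x g.
Proof. by move=> h; rewrite /inv (eq_im _ h). Qed.

Lemma bruhats_eq d (x y : bruhats d) : projT1 x = projT1 y ->
  (forall f, incr d.+1 f -> below d.+1 (projT1 x) f -> inv x f = inv y f) ->
  x = y.
Proof.
case: x y => n b [m c] /= e; case: m / e c => c h; congr existT.
apply: Inv_inj; apply/setP=> L; have [|LD] := boolP (L \in dsubs n d.+1).
  by rewrite inE => /eqP/im_surj[f [inc bnd ->]]; apply: h.
by rewrite !(contraNF (subsetP (Inv_sub _) L)).
Qed.

Lemma low_cases r b f i : incr r f -> i < r ->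
  i < low r b f /\ f i < b \/ low r b f <= i /\ b <= f i.
Proof. by move=> inc ir; have := low_incr b inc ir; case: ltnP; case: ltnP; auto. Qed.

Lemma inv_insertT d (x y : bruhats d) j f : 0 < d ->
  d <= projT1 y -> j + d <= projT1 x ->
  incr d.+1 f -> below d.+1 (projT1 x + projT1 y - d) f ->
  inv (insertT x (j, y)) f =
  if (j <= f 0) && (f d < j + projT1 y) then inv y (fun i => f i - j)
  else inv x (collapse d j (projT1 y) (low d.+1 (j + projT1 y) f) f).
Proof.
move=> d0 dy jx inc bnd; rewrite /inv /insertT /= Inv_insertion //; try lia.
exact: mem_insertion_set.
Qed.

Lemma not_in_block d j m f : incr d.+1 f ->
  ~~ ((j <= f 0) && (f d < j + m)) ->
  small_block d j (low d.+1 (j + m) f) f.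
Proof.
move=> inc nB i ie; have le := low_le d.+1 (j + m) f.
have := low_cases (j + m) inc (ltnSn d); have -> : i = 0 by lia.
by move: nB; rewrite negb_and -ltnNge -leqNgt => /orP[//|]; lia.
Qed.

(** The three regimes of [collapse]; the first one uses that the elements to the
    left of the block leave room for the bound. *)
Lemma collapse_cases d j m r e f k : incr r f -> e <= r ->
  (forall i, i < r -> (f i < j + m) = (i < e)) -> small_block d j e f -> k < r ->
  [\/ f k < j /\ collapse d j m e f k = f k,
      [/\ j <= f k, f k < j + m, k < e, e <= k + d &
          collapse d j m e f k = minn (f k) (j + d + k - e)] |
      [/\ j + m <= f k, e <= k & collapse d j m e f k = f k - (m - d)]].
Proof.
move=> inc er he nb kr; have hk := he k kr; have eb := small_block_bound inc er nb.
have [fj|fj] := ltnP (f k) j.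
  apply: Or31; split=> //; rewrite /collapse; have -> : k < e by rewrite -hk; lia.
  have [ek|ek] := leqP e (k + d); first by lia.
  by have := nb (e - d.+1); have := @incr_gap _ f k (e - d.+1) inc; lia.
have [ke|ke] := ltnP k e.
  apply: Or32; rewrite /collapse ke; split=> //; first by rewrite hk.
  by rewrite leqNgt; apply/negP => /nb; lia.
by apply: Or33; rewrite /collapse ltnNge ke; split=> //; rewrite leqNgt hk -leqNgt.
Qed.

(** For a set not contained in the outer block, the bound that the inner collapse
    imposes on an element is at least the one of the outer collapse, so the
    composite of both is the collapse of the enlarged block. *)
Lemma insertT_assoc d (x y z : bruhats d) j i : 0 < d ->
  d <= projT1 y -> d <= projT1 z -> j + d <= projT1 x -> i + d <= projT1 y ->
  insertT (insertT x (j, y)) (j + i, z) = insertT x (j, insertT y (i, z)).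
Proof.
move=> d0 dy dz jx iy; apply: bruhats_eq => [/=|f inc bnd]; first by lia.
have sX : projT1 (insertT x (j, y)) = projT1 x + projT1 y - d by [].
have sY : projT1 (insertT y (i, z)) = projT1 y + projT1 z - d by [].
rewrite /= in bnd.
have bndY : below d.+1 (projT1 x + projT1 (insertT y (i, z)) - d) f.
  by move=> k kd; have := bnd k kd; rewrite sY; lia.
rewrite inv_insertT //; last by rewrite sX; lia.
rewrite [RHS]inv_insertT // sY; last by lia.
have f0d := incr_le inc (leq0n d) (ltnSn d).
have L k := @low_cases d.+1 (j + i + projT1 z) f k inc.
have K k := @low_cases d.+1 (j + (projT1 y + projT1 z - d)) f k inc.
set e := low _ _ _ in L *; set E := low _ _ f in K *.
case: ifP => [/andP[z0 z1]|/negbT nz].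
  have -> : (j <= f 0) && (f d < j + (projT1 y + projT1 z - d)) by lia.
  have incj : incr d.+1 (fun k => f k - j).
    by move=> a b ab bd; have := inc _ _ ab bd; have := incr_le inc (leq0n a) (ltn_trans ab bd); lia.
  rewrite inv_insertT //; last by move=> k kd; have := incr_le inc (kd : k <= d) (ltnSn d); lia.
  have -> : (i <= f 0 - j) && (f d - j < i + projT1 z) by lia.
  by apply: eq_inv => k _; lia.
have nb := not_in_block inc nz.
have eb := small_block_bound inc (low_le _ _ _) nb.
have he k (kd : k < d.+1) := low_incr (j + i + projT1 z) inc kd.
have ic := collapse_incr dz inc (low_le _ _ _) he nb.
have jX : j + i + d <= projT1 x + projT1 y - d by lia.
have bc := collapse_below dz jX eb he bnd.
rewrite -/e in nb eb he ic bc *.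
rewrite inv_insertT //.
set g := collapse _ _ _ _ _ in ic bc *.
have G k := @low_cases d.+1 (j + projT1 y) g k ic.
set e' := low _ _ g in G *.
have er : e <= d.+1 by apply: low_le.
have Er : E <= d.+1 by apply: low_le.
have eE : e <= E.
  by rewrite leqNgt; apply/negP => h; have := L E; have := K E; lia.
have gE k : k < d.+1 -> (g k < j + projT1 y) = (k < E).
  move=> kd; have := L k kd; have := K k kd; rewrite /g /collapse.
  by case: (ltnP k e) => ke; case: (ltnP k E) => kE; [move=> *; apply/idP|..]; lia.
have {G e'} -> : e' = E by apply: low_eq.
have i0 : j <= f 0 -> e <= i + d by have := nb 0; lia.
have -> : (j <= g 0) = (j <= f 0).
  rewrite /g /collapse; have := L 0 (ltn0Sn d).
  by case: (ltnP 0 e) => ke hL; apply/idP/idP; lia.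
have -> : (g d < j + projT1 y) = (f d < j + (projT1 y + projT1 z - d)).
  by rewrite gE //; have := K d (ltnSn d); case: (ltnP d E) => ke hL; apply/esym/idP; lia.
case: ifP => [/andP[y0 y1]|/negbT ny].
  have incj : incr d.+1 (fun k => f k - j).
    by move=> a b ab bd; have := inc _ _ ab bd; have := incr_le inc (leq0n a) (ltn_trans ab bd); lia.
  have bj : below d.+1 (projT1 y + projT1 z - d) (fun k => f k - j).
    by move=> k kd; have := incr_le inc (kd : k <= d) (ltnSn d); lia.
  rewrite inv_insertT //.
  have -> : (i <= f 0 - j) && (f d - j < i + projT1 z) = false by apply/negbTE; lia.
  have -> : low d.+1 (i + projT1 z) (fun k => f k - j) = e.
    apply: low_eq => // k kd; rewrite -he //; have := incr_le inc (leq0n k) kd.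
    by move=> h; apply/idP/idP; lia.
  apply: eq_inv => k kd; rewrite /g /collapse; have := incr_le inc (leq0n k) kd.
  by have := i0 y0; have := L k kd; case: (ltnP k e) => ke; lia.
have nbE := not_in_block inc ny; rewrite -/E in nbE.
have Eb := small_block_bound inc Er nbE.
have nbg : small_block d j E g.
  move=> k kE; have kd : k < d.+1 by lia.
  by have := nbE k kE; rewrite /g; case: (collapse_cases inc er he nb kd) => [[? ->]|[? ? ? ? _]|[? ? _]] //; lia.
have hE k (kd : k < d.+1) : (f k < j + (projT1 y + projT1 z - d)) = (k < E) :=
  low_incr _ inc kd.
apply: eq_inv => k kd; have := collapse_cases ic Er gE nbg kd.
have := collapse_cases inc Er hE nbE kd; have := collapse_cases inc er he nb kd.
rewrite -/g; move: (f k) (g k) (collapse _ _ _ _ g k) (collapse _ _ _ _ f k) => fk gk u v.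
move: eE dy dz iy Eb eb; clear; set m := projT1 y; set l := projT1 z; move: m l => m l.
move=> eE dy dz iy Eb eb.
by case=> [[? ->]|[? ? ? ? ->]|[? ? ->]]; case=> [[? ->]|[? ? ? ? ->]|[? ? ->]];
  case=> [[? ->]|[? ? ? ? ->]|[? ? ->]]; lia.
Qed.

(** Each of the two collapses fixes, up to translation, the elements outside its
    own block, and neither moves an element into or out of the other block. *)
Lemma insertT_comm d (x y z : bruhats d) i j : 0 < d ->
  d <= projT1 y -> d <= projT1 z -> i + d <= j -> j + d <= projT1 x ->
  insertT (insertT x (i, y)) (j + projT1 y - d, z) = insertT (insertT x (j, z)) (i, y).
Proof.
move=> d0 dy dz ij jx; apply: bruhats_eq => [/=|f inc bnd]; first by lia.
have sY : projT1 (insertT x (i, y)) = projT1 x + projT1 y - d by [].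
have sZ : projT1 (insertT x (j, z)) = projT1 x + projT1 z - d by [].
rewrite /= in bnd.
have bndZ : below d.+1 (projT1 x + projT1 z - d + projT1 y - d) f.
  by move=> k kd; have := bnd k kd; lia.
rewrite inv_insertT //; last by rewrite sY; lia.
rewrite [RHS]inv_insertT // ?sZ //; last by lia.
set J := j + projT1 y - d; have iJ : i + projT1 y <= J by lia.
have f0d := incr_le inc (leq0n d) (ltnSn d).
have g0 k (kd : k < d.+1) := incr_le inc (leq0n k) kd.
have gd k (kd : k < d.+1) := incr_le inc (kd : k <= d) (ltnSn d).
case: ifP => [/andP[z0 z1]|/negbT nz].
  have -> : (i <= f 0) && (f d < i + projT1 y) = false by apply/negbTE; lia.
  have Ek k : k < d.+1 ->
      collapse d i (projT1 y) (low d.+1 (i + projT1 y) f) f k = f k - (projT1 y - d).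
    move=> kd; rewrite /collapse -low_incr //; case: ifP => //; have := g0 k kd; lia.
  rewrite inv_insertT //.
  - rewrite !Ek //; have -> : (j <= f 0 - (projT1 y - d)) &&
      (f d - (projT1 y - d) < j + projT1 z) by lia.
    by apply: eq_inv => k kd; rewrite Ek //; lia.
  - move=> a b ab bd; rewrite !Ek ?(ltn_trans ab bd) //.
    by have := inc _ _ ab bd; have := g0 a (ltn_trans ab bd); lia.
  - by move=> k kd; rewrite Ek //; have := bnd k kd; have := g0 k kd; lia.
have nbz := not_in_block inc nz; set e := low _ _ _ in nbz *.
have er : e <= d.+1 by apply: low_le.
have eb := small_block_bound inc er nbz.
have he k (kd : k < d.+1) : (f k < J + projT1 z) = (k < e) := low_incr _ inc kd.
have ig := collapse_incr dz inc er he nbz.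
have Jx : J + d <= projT1 x + projT1 y - d by lia.
have bg := collapse_below dz Jx eb he bnd.
have G k (kd : k < d.+1) := collapse_cases inc er he nbz kd.
set g := collapse _ _ _ _ _ in ig bg G *; rewrite inv_insertT //; last by lia.
set E := low d.+1 (i + projT1 y) f.
have Er : E <= d.+1 by apply: low_le.
have hE k (kd : k < d.+1) : (f k < i + projT1 y) = (k < E) := low_incr _ inc kd.
have gE k : k < d.+1 -> (g k < i + projT1 y) = (k < E).
  by move=> kd; rewrite -hE //; apply/idP/idP; case: (G k kd) => [[? ->]|[? ? ? ? ->]|[? ? ->]]; lia.
have -> : low d.+1 (i + projT1 y) g = E by apply: low_eq.
have -> : (i <= g 0) = (i <= f 0).
  by apply/idP/idP; case: (G 0 (ltn0Sn d)) => [[? ->]|[? ? ? ? ->]|[? ? ->]]; lia.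
have -> : (g d < i + projT1 y) = (f d < i + projT1 y) by rewrite gE // hE.
case: ifP => [/andP[y0 y1]|/negbT ny].
  apply: eq_inv => k kd; have := gd k kd.
  by case: (G k kd) => [[? ->]|[? ? ? ? ->]|[? ? ->]]; lia.
have nby := not_in_block inc ny; rewrite -/E in nby.
have Eb := small_block_bound inc Er nby.
have ih := collapse_incr dy inc Er hE nby.
have ix : i + d <= projT1 x + projT1 z - d by lia.
have bh := collapse_below dy ix Eb hE bndZ.
have H k (kd : k < d.+1) := collapse_cases inc Er hE nby kd.
set h := collapse _ _ _ _ f in ih bh H *; rewrite inv_insertT //.
have -> : (j <= h 0) && (h d < j + projT1 z) = false.
  apply: contraNF nz => /andP[h0 h1]; apply/andP; split.
    by move: h0; case: (H 0 (ltn0Sn d)) => [[? ->]|[? ? ? ? ->]|[? ? ->]]; lia.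
  by move: h1; case: (H d (ltnSn d)) => [[? ->]|[? ? ? ? ->]|[? ? ->]]; lia.
have -> : low d.+1 (j + projT1 z) h = e.
  apply: low_eq => // k kd; rewrite -he //.
  by apply/idP/idP; case: (H k kd) => [[? ->]|[? ? ? ? ->]|[? ? ->]]; lia.
have nbg : small_block d i E g.
  move=> k kE; have kd : k < d.+1 by lia.
  by have := nby k kE; case: (G k kd) => [[? ->]|[? ? ? ? ->]|[? ? ->]]; lia.
have nbh : small_block d j e h.
  move=> k ke; have kd : k < d.+1 by lia.
  by have := nbz k ke; case: (H k kd) => [[? ->]|[? ? ? ? ->]|[? ? ->]]; lia.
have hh k (kd : k < d.+1) : (h k < j + projT1 z) = (k < e).
  rewrite -he //; apply/idP/idP; case: (H k kd) => [[? ->]|[? ? ? ? ->]|[? ? ->]]; lia.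
apply: eq_inv => k kd; have := collapse_cases ih er hh nbh kd.
have := collapse_cases ig Er gE nbg kd; have := H k kd; have := G k kd.
move: (f k) (g k) (h k) (collapse _ _ _ _ g k) (collapse _ _ _ _ h k) => fk gk hk u v.
have eJ : J = j + (projT1 y - d) by rewrite /J addnBA.
move: eJ ij dy dz; clearbody E e; clear; move: (projT1 y) (projT1 z) J => m l J eJ ij dy dz.
by case=> [[? ->]|[? ? ? ? ->]|[? ? ->]]; case=> [[? ->]|[? ? ? ? ->]|[? ? ->]];
  case=> [[? ->]|[? ? ? ? ->]|[? ? ->]]; case=> [[? ->]|[? ? ? ? ->]|[? ? ->]]; lia.
Qed.

(** * Iterated insertions *)

Section Lists.
Variable d : nat.
Implicit Types (x y z : bruhats d) (s : seq (nat * bruhats d)).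

(** The nuclei that a chain of insertions refers to exist; [n] is the size of the
    ground set at the current stage. *)
Fixpoint fits n s : bool :=
  if s is (p, b) :: s' then
    [&& p + d <= n, d <= projT1 b & fits (n + projT1 b - d) s']
  else true.

Definition shift k s := [seq (t.1 + k, t.2) | t <- s].

Definition gain s := sumn [seq projT1 t.2 - d | t <- s].

Lemma shift_add k l s : shift k (shift l s) = shift (l + k) s.
Proof. by rewrite /shift -map_comp; apply: eq_map => -[p b] /=; rewrite addnA. Qed.

Lemma shift0 s : shift 0 s = s.
Proof. by rewrite -[RHS]map_id; apply: eq_map => -[p b] /=; rewrite addn0. Qed.

Lemma fits_shift n k s : fits n s -> fits (n + k) (shift k s).
Proof.
elim: s n => [|[p b] s IHs] n //= /and3P[h1 -> /IHs h]; rewrite /=.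
by apply/andP; split; [lia | have -> : n + k + projT1 b - d = n + projT1 b - d + k by lia].
Qed.

Lemma size_foldl x s : d <= projT1 x -> fits (projT1 x) s ->
  projT1 (foldl (@insertT d) x s) = projT1 x + gain s.
Proof.
elim: s x => [|[p b] s IHs] x dx /=; first by rewrite addn0.
move=> /and3P[pd db fs]; rewrite (IHs (insertT x (p, b))) //=; last by lia.
by rewrite /gain /=; lia.
Qed.

Hypothesis d0 : 0 < d.

Lemma insertT_foldl x y p s : d <= projT1 y -> p + d <= projT1 x ->
  fits (projT1 y) s ->
  insertT x (p, foldl (@insertT d) y s) =
  foldl (@insertT d) (insertT x (p, y)) (shift p s).
Proof.
elim: s y => [|[q c] s IHs] y dy px //= /and3P[qd dc fs].
rewrite (IHs (insertT y (q, c))) //=; last by lia.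
by rewrite -(insertT_assoc d0 dy dc px qd) addnC.
Qed.

Lemma insertT_foldl_swap x q c s : d <= projT1 c ->
  all (fun t => q + d <= t.1) s -> fits (projT1 x) s ->
  insertT (foldl (@insertT d) x s) (q, c) =
  foldl (@insertT d) (insertT x (q, c)) (shift (projT1 c - d) s).
Proof.
move=> dc; elim: s x => [|[p b] s IHs] x //= /andP[qp qs] /and3P[pd db fs].
rewrite (IHs (insertT x (p, b))) // -(insertT_comm d0 dc db qp pd).
by rewrite addnBA.
Qed.

(** This iterates [insertT_comm] over both lists; [fits B t] makes sure that [t]
    stays to the left of [s]. *)
Lemma foldl_swap x B s (t : seq (nat * bruhats d)) : all (fun u => B <= u.1) s -> fits (projT1 x) s ->
  fits B t ->
  foldl (@insertT d) x (s ++ t) = foldl (@insertT d) x (t ++ shift (gain t) s).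
Proof.
elim: t x B s => [|[q c] t IHt] x B s Bs fs; first by rewrite shift0 cats0.
move=> /= /and3P[qB dc ft]; rewrite -cat1s catA foldl_cat foldl_cat /=.
rewrite (insertT_foldl_swap dc) //; last by apply: sub_all Bs => u /=; lia.
rewrite -foldl_cat (IHt _ (B + projT1 c - d)) //.
- by rewrite shift_add.
- by rewrite all_map; apply: sub_all Bs => u /=; lia.
by have := fits_shift (projT1 c - d) fs; rewrite /= addnBA.
Qed.

(** A block [(p, P, b, c)] stands for the insertion of [b] at [p] followed by
    the insertions [c] into [b]; [P] is the position of [b] once the insertions
    into the earlier blocks, which enlarge the ground set by [o], are made. *)
Local Notation block := (nat * nat * bruhats d * seq (nat * bruhats d))%type.

(** [lo] is a lower bound for the positions, kept in order to know that the blocks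
    are disjoint and go from left to right. *)
Fixpoint good lo n o (s : seq block) : Prop :=
  if s is (p, P, b, c) :: s' then
    [/\ lo <= p, p + d <= n, P = p + o, d <= projT1 b /\ fits (projT1 b) c &
        good (p + projT1 b) (n + projT1 b - d) (o + gain c) s']
  else True.

Definition outer (bs : seq block) := [seq (t.1.1.1, t.1.2) | t <- bs].
Definition inner (bs : seq block) := flatten [seq shift t.1.1.2 t.2 | t <- bs].
Definition merged (bs : seq block) :=
  [seq (t.1.1.2, foldl (@insertT d) t.1.2 t.2) | t <- bs].

Lemma good_fits lo n o (s : seq block) : good lo n o s -> fits n (outer s).
Proof.
by elim: s lo n o => [|[[[p P] b] c] s IHs] lo n o //= [_ -> _ [-> _] /IHs].
Qed.

Lemma good_lo lo n o (s : seq block) : good lo n o s -> all (fun u => lo <= u.1) (outer s).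
Proof.
elim: s lo n o => [|[[[p P] b] c] s IHs] lo n o //= [lp _ _ [db _] /IHs h].
by rewrite lp; apply: sub_all h => u /=; lia.
Qed.

(** The inner insertions of the first block are moved to the left past the outer
    insertions of all later blocks; the offset [o] records the resulting
    translation of the latter. *)
Lemma foldl_blocks x lo n o (s : seq block) : good lo n o s -> projT1 x = n + o ->
  foldl (@insertT d) x (shift o (outer s) ++ inner s) =
  foldl (@insertT d) x (merged s).
Proof.
elim: s x lo n o => [|[[[p P] b] c] s IHs] x lo n o //=.
move=> [lp pn eP [db fc] gs] sx.
have Px : P + d <= projT1 x by lia.
rewrite /inner /= -/(inner s) catA foldl_cat.
rewrite (@foldl_swap _ (projT1 b + P)).
- rewrite -foldl_cat -catA foldl_cat -eP -insertT_foldl //.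
  have -> : gain (shift P c) = gain c by rewrite /gain -map_comp.
  rewrite shift_add (IHs _ _ _ _ gs) //= size_foldl //; lia.
- by rewrite all_map; apply: sub_all (good_lo gs) => u /=; lia.
- have := fits_shift o (good_fits gs); rewrite /= sx.
  by have -> : n + o + projT1 b - d = n + projT1 b - d + o by lia.
- exact: fits_shift.
Qed.

End Lists.

(** * Sums over concatenated families *)

(** This is [nuclei_before] for numbers of nuclei; it is also applied to sizes and
    to numbers of electrons. *)
Definition psum k (F : 'I_k -> nat) (i : nat) := \sum_(l < k | l < i) F l.

Lemma psumS k (F : 'I_k -> nat) (i : 'I_k) : psum F i.+1 = psum F i + F i.
Proof.
rewrite /psum (bigD1 i) ?ltnSn //= addnC; congr (_ + _); apply: eq_bigl => l.
by rewrite ltnS andbC -val_eqE /= ltn_neqAle.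
Qed.

Lemma psum0 k (F : 'I_k -> nat) : psum F 0 = 0.
Proof. by rewrite /psum big_pred0. Qed.

Lemma psum_full k (F : 'I_k -> nat) i : k <= i -> psum F i = \sum_l F l.
Proof. by move=> ki; apply: eq_bigl => l; rewrite (leq_trans _ ki). Qed.

Lemma leq_psum k (F : 'I_k -> nat) i j : i <= j -> psum F i <= psum F j.
Proof.
move=> ij; rewrite /psum [leqRHS](bigID (fun l : 'I_k => l < i)) /=.
apply: leq_trans (leq_addr _ _); rewrite [leqRHS](eq_bigl (fun l : 'I_k => l < i)) // => l.
by case: (ltnP l i) => li; rewrite ?andbF // (leq_trans li ij).
Qed.

Lemma psum_const k c i : i <= k -> psum (fun _ : 'I_k => c) i = i * c.
Proof.
by move=> ik; rewrite /psum -(big_ord_widen _ (fun=> c) ik) sum_nat_const card_ord.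
Qed.

Lemma psum_add k (F G : 'I_k -> nat) i :
  psum (fun l => F l + G l) i = psum F i + psum G i.
Proof. exact: big_split. Qed.

Lemma sum_split k (F : 'I_k -> nat) (i : 'I_k) :
  (forall l : 'I_k, i < l -> F l = 0) -> \sum_l F l = psum F i + F i.
Proof.
move=> h; rewrite -psumS /psum [LHS](bigID (fun l : 'I_k => l < i.+1)) /=.
by rewrite [X in _ + X]big1 ?addn0 // => l; rewrite -leqNgt => /h.
Qed.

Section Flat.
Variables (k : nat) (n : 'I_k -> nat).

Definition flat T (g : forall i, 'I_(n i) -> T) (s : 'I_(\sum_(i < k) n i)) :=
  g (tagnat.sig1 s) (tagnat.sig2 s).

Lemma flat_Rank T (g : forall i, 'I_(n i) -> T) (i : 'I_k) (j : 'I_(n i)) :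
  flat g (tagnat.Rank i j) = g i j.
Proof.
rewrite /flat /tagnat.sig1 /tagnat.sig2 /tagnat.Rank.
by rewrite -[RHS]/(g (tag (Tagged (fun i => 'I_(n i)) j)) (tagged (Tagged (fun i => 'I_(n i)) j))) tagnat.rankK.
Qed.

Lemma val_Rank (i : 'I_k) (j : 'I_(n i)) : tagnat.Rank i j = psum n i + j :> nat.
Proof. exact: tagnat.RankEsum. Qed.

Lemma big_flat (P : pred 'I_(\sum_(i < k) n i)) (F : 'I_(\sum_(i < k) n i) -> nat) :
  \sum_(s | P s) F s =
  \sum_(i < k) \sum_(j < n i | P (tagnat.Rank i j)) F (tagnat.Rank i j).
Proof.
rewrite (reindex_onto _ _ (fun s _ => tagnat.sigK s)) /=.
rewrite sig_big_dep /=.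
apply: eq_big => [[i j]|[i j] _] //=.
by rewrite tagnat.rankK eqxx andbT.
Qed.

Lemma lt_psum (i i' : 'I_k) j j' : j <= n i -> j' < n i' ->
  (psum n i' + j' < psum n i + j) = (i' < i) || (i' == i) && (j' < j).
Proof.
move=> ji ji'; have [lt|gt|/val_inj e] := ltngtP i' i.
- by have := leq_psum n lt; rewrite psumS; lia.
- rewrite -val_eqE /= gtn_eqF //=; apply/negbTE.
  by have := leq_psum n gt; rewrite psumS; lia.
by rewrite e eqxx ltn_add2l.
Qed.

(** Sums over the flattened index set come from the composite of a composite, the
    nested sums from the composite of composites. *)
Lemma psum_flat (g : forall i, 'I_(n i) -> nat) (i : 'I_k) j : j <= n i ->
  psum (flat g) (psum n i + j) = psum (fun i => \sum_j g i j) i + psum (g i) j.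
Proof.
move=> ji; rewrite {1}/psum big_flat (@sum_split _ _ i) => [|l il]; last first.
  rewrite big_pred0 // => j'; rewrite val_Rank lt_psum //.
  by rewrite -val_eqE /= gtn_eqF // ltnNge ltnW.
congr (_ + _).
  apply: eq_bigr => l li; apply: eq_big => [j'|j' _]; last by rewrite flat_Rank.
  by rewrite val_Rank lt_psum // li.
apply: eq_big => [j'|j' _]; last by rewrite flat_Rank.
by rewrite val_Rank lt_psum // ltnn eqxx.
Qed.

Lemma psum_flat_full (g : forall i, 'I_(n i) -> nat) i : i <= k ->
  psum (flat g) (psum n i) = psum (fun i => \sum_j g i j) i.
Proof.
rewrite leq_eqVlt => /orP[/eqP->|ik].
  rewrite !psum_full // big_flat; apply: eq_bigr => l _.
  by apply: eq_bigr => j _; rewrite flat_Rank.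
by have := psum_flat g (i := Ordinal ik) (leq0n _); rewrite addn0 psum0 addn0.
Qed.

Lemma enum_drop (i : 'I_k) : drop i (enum 'I_k) = i :: drop i.+1 (enum 'I_k).
Proof. by rewrite (drop_nth i) ?size_enum_ord // nth_ord_enum. Qed.

Lemma flatten_iota i0 : i0 <= k ->
  flatten [seq iota (psum n i) (n i) | i : 'I_k <- drop i0 (enum 'I_k)] =
  iota (psum n i0) (\sum_i n i - psum n i0).
Proof.
have [m] := ubnP (k - i0); elim: m i0 => // m IHm i0 hm.
rewrite leq_eqVlt => /orP[/eqP->|ik].
  by rewrite drop_oversize ?size_enum_ord // psum_full // subnn.
rewrite (enum_drop (Ordinal ik)) /= IHm //; last by lia.
have le : psum n i0.+1 <= \sum_i n i.
  by rewrite -(@psum_full _ n k) //; apply: leq_psum.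
rewrite (psumS _ (Ordinal ik)) /= in le *; rewrite -iotaD /=; congr iota; lia.
Qed.

Lemma enum_flat :
  enum 'I_(\sum_(i < k) n i) =
  flatten [seq [seq tagnat.Rank i j | j <- enum 'I_(n i)] | i <- enum 'I_k].
Proof.
apply: (inj_map val_inj); rewrite val_enum_ord map_flatten -map_comp.
have := flatten_iota (leq0n k); rewrite drop0 psum0 subn0 => <-.
congr flatten; apply: eq_map => i /=; rewrite -map_comp.
rewrite -[psum n i]addn0 iotaDl -val_enum_ord -map_comp.
by apply: eq_map => j; apply/esym/val_Rank.
Qed.

End Flat.

(** * Types *)

Lemma sum_fiber_on N (T : finType) (f g : T -> nat) (A : pred nat) :
  (forall i, g i <= N) ->
  \sum_(t < N.+1 | A t) \sum_(i | g i == t) f i = \sum_(i | A (g i)) f i.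
Proof.
move=> hg; rewrite (exchange_big_dep (fun i => A (g i))) /=; last first.
  by move=> t i At /eqP->.
apply: eq_bigr => i Ai; have hi : g i < N.+1 by rewrite ltnS.
rewrite (big_pred1 (Ordinal hi)) // => t /=.
rewrite -[RHS]val_eqE /= [RHS]eq_sym; by case: eqP => [<-|_]; rewrite ?Ai ?andbF.
Qed.

Lemma sum_type_comp k (l : 'I_k -> nat) (a : nuclei_type k)
  (m : forall i, nuclei_type (l i)) (A : pred nat) :
  \sum_(t < (\sum_(i < k) l i).+1 | A t) type_comp a m t =
  \sum_(i < k.+1 | A (psum l i)) a i +
  \sum_(i < k) \sum_(p < (l i).+1 | A (psum l i + p)) m i p.
Proof.
under [LHS]eq_bigr do rewrite ffunE.
rewrite big_split /= sum_fiber_on; last by move=> i; apply: nuclei_before_le.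
congr (_ + _); rewrite exchange_big; apply: eq_bigr => i _.
by rewrite (sum_fiber_on (m i)) // => p; apply: nuclei_before_add_le.
Qed.

(** [type_comp] pushes the entries forward along the maps that number the gaps
    between nuclei, so this is the compatibility of these maps, [psum_flat]. *)
Lemma type_comp_assoc k (n : 'I_k -> nat) (p : forall i, 'I_(n i) -> nat)
  (a : nuclei_type k) (b : forall i, nuclei_type (n i))
  (c : forall i j, nuclei_type (p i j))
  (t : 'I_(\sum_s flat p s).+1) (t' : 'I_(\sum_i \sum_j p i j).+1) : t = t' :> nat ->
  type_comp (type_comp a b) (fun s => c (tagnat.sig1 s) (tagnat.sig2 s)) t =
  type_comp a (fun i => type_comp (b i) (c i)) t'.
Proof.
move=> ett; rewrite !ffunE -!ett -!/(psum _ _).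
rewrite (@sum_type_comp _ _ a b (fun s => psum (flat p) s == t)) -addnA; congr (_ + _).
  by apply: eq_bigl => i; rewrite psum_flat_full // -ltnS.
under [X in _ = X]eq_bigr => i _ do
  rewrite (@sum_type_comp _ _ (b i) (c i) (fun s => psum (fun i => \sum_j p i j) i + s == t)).
rewrite big_split /=; congr (_ + _).
  apply: eq_bigr => i _; apply: eq_bigl => q.
  by rewrite psum_flat // -ltnS.
rewrite big_flat; apply: eq_bigr => i _; apply: eq_bigr => j _.
pose F i j := \sum_(u < (p i j).+1 | psum (flat p) (psum n i + j) + u == t) c i j u.
transitivity (flat F (tagnat.Rank i j)).
  by rewrite /flat /F -tagnat.rect.
rewrite flat_Rank; apply: eq_bigl => u.
by rewrite psum_flat ?addnA // ltnW.
Qed.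

(** * Positions *)

Lemma good_enum d k (N : nat) (p P : 'I_k -> nat) (B : 'I_k -> bruhats d)
  (C : 'I_k -> seq (nat * bruhats d)) :
  (forall i, P i = p i + psum (fun l => gain (C l)) i) ->
  (forall i i' : 'I_k, i' = i.+1 :> nat -> p i + projT1 (B i) <= p i') ->
  (forall i, p i + d <= N + psum (fun l => projT1 (B l) - d) i) ->
  (forall i, d <= projT1 (B i)) -> (forall i, fits (projT1 (B i)) (C i)) ->
  good 0 N 0 [seq (p i, P i, B i, C i) | i <- enum 'I_k].
Proof.
move=> hP hp hN hB hC.
pose bl i := (p i, P i, B i, C i).
suff key i0 lo : i0 <= k -> (forall i : 'I_k, i = i0 :> nat -> lo <= p i) ->
    good lo (N + psum (fun l => projT1 (B l) - d) i0) (psum (fun l => gain (C l)) i0)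
      [seq bl i | i <- drop i0 (enum 'I_k)].
  by have := key 0 0 (leq0n k) (fun _ _ => leq0n _); rewrite drop0 !psum0 addn0.
have [m] := ubnP (k - i0); elim: m i0 lo => // m IHm i0 lo hm.
rewrite leq_eqVlt => /orP[/eqP->|ik] hlo; first by rewrite drop_oversize // size_enum_ord.
pose i := Ordinal ik; rewrite (enum_drop i) /=; split.
- exact: hlo.
- exact: hN.
- exact: hP.
- by split.
have /= e1 := psumS (fun l => projT1 (B l) - d) i.
have /= e2 := psumS (fun l => gain (C l)) i.
rewrite -e2; have -> : N + psum (fun l => projT1 (B l) - d) i0 + projT1 (B i) - d =
    N + psum (fun l => projT1 (B l) - d) i0.+1 by have := hB i; rewrite e1; lia.
by apply: IHm => //; [lia | move=> i' ei'; apply: hp].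
Qed.

Definition HB_list d k (n : 'I_k -> nat) (a : HB d k) (b : forall i, HB d (n i)) :=
  [seq (HB_pos a b i, mkB (HB_order (b i))) | i <- enum 'I_k].

Lemma HB_posE d k (n : 'I_k -> nat) (a : HB d k) (b : forall i, HB d (n i)) i :
  HB_pos a b i = psum (HB_type a) i.+1 + psum (fun l => HB_size (b l)) i.
Proof. by []. Qed.

Lemma HB_sizeE d k (a : HB d k) : HB_size a = k * d + \sum_i HB_type a i.
Proof. by rewrite -(HB_type_size a). Qed.

Lemma HB_pos_step d k (n : 'I_k -> nat) (a : HB d k) (b : forall i, HB d (n i))
  (i i' : 'I_k) : i' = i.+1 :> nat -> HB_pos a b i + HB_size (b i) <= HB_pos a b i'.
Proof.
move=> e; rewrite !HB_posE e psumS -addnA leq_add2r.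
exact: leq_psum.
Qed.

Lemma HB_pos_le d k (n : 'I_k -> nat) (a : HB d k) (b : forall i, HB d (n i))
  (i : 'I_k) :
  HB_pos a b i + d <= HB_size a + psum (fun l => HB_size (b l) - d) i.
Proof.
rewrite HB_posE HB_sizeE.
have -> : psum (fun l => HB_size (b l)) i = psum (fun l => HB_size (b l) - d) i + i * d.
  rewrite -(psum_const d (ltnW (ltn_ord i))).
  by rewrite -psum_add; apply: eq_bigr => l _; rewrite subnK // HB_size_ge.
have h1 : psum (HB_type a) i.+1 <= \sum_l HB_type a l.
  by rewrite -(@psum_full _ _ k.+1) //; apply: leq_psum; apply: ltnW; rewrite ltnS.
have h2 : i * d + d <= k * d by rewrite -mulSnr leq_mul2r ltn_ord orbT.
lia.
Qed.

Lemma HB_list_fits d k (n : 'I_k -> nat) (a : HB d k) (b : forall i, HB d (n i)) :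
  fits (HB_size a) (HB_list a b).
Proof.
pose bl i := (HB_pos a b i, HB_pos a b i, mkB (HB_order (b i)), [::] : seq (nat * bruhats d)).
suff /good_fits : good 0 (HB_size a) 0 [seq bl i | i <- enum 'I_k] by rewrite /outer -map_comp.
apply: good_enum => [i|i i'|i|i|//].
- by rewrite /psum big1 ?addn0.
- exact: HB_pos_step.
- exact: HB_pos_le.
- exact: HB_size_ge.
Qed.

Lemma mkB_projT2 d (x : bruhats d) : mkB (projT2 x) = x.
Proof. by case: x. Qed.

Lemma size_HB_comp d k (n : 'I_k -> nat) (hk : 0 < k) (hn : forall i, 0 < n i)
  (a : HB d k) (b : forall i, HB d (n i)) :
  HB_size (HB_comp hk hn a b) = HB_size a + gain (HB_list a b).
Proof. exact: (@size_foldl d (mkB (HB_order a)) _ (HB_size_ge a) (HB_list_fits a b)). Qed.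

Lemma size_HB_comp_sum d k (n : 'I_k -> nat) (hk : 0 < k) (hn : forall i, 0 < n i)
  (a : HB d k) (b : forall i, HB d (n i)) :
  HB_size (HB_comp hk hn a b) = \sum_i HB_type a i + \sum_i HB_size (b i).
Proof.
have e := type_comp_size d (HB_type a) (fun i => HB_type (b i)).
have {e} : HB_size (HB_comp hk hn a b) + k * d = HB_size a + \sum_i HB_size (b i).
  rewrite -(HB_type_size (HB_comp hk hn a b)) -(HB_type_size a) e; congr (_ + _).
  by apply: eq_bigr => i _; rewrite HB_type_size.
by rewrite (HB_sizeE a); lia.
Qed.

Section Assoc.
Variables (d : nat) (d0 : 0 < d) (k : nat) (n : 'I_k -> nat).
Variable p : forall i, 'I_(n i) -> nat.
Arguments p : clear implicits.
Variables (hk : 0 < k) (hn : forall i, 0 < n i) (hp : forall i j, 0 < p i j).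
Arguments hp : clear implicits.
Variables (a : HB d k) (b : forall i, HB d (n i)) (c : forall i j, HB d (p i j)).
Arguments c : clear implicits.

Local Notation ab := (HB_comp hk hn a b).
Local Notation bc := (fun i => HB_comp (hn i) (hp i) (b i) (c i)).
Local Notation cc := (fun s => c (tagnat.sig1 s) (tagnat.sig2 s)).

(** The nucleus of [c i j] is found by going to the place of [b i] in the outer
    type and then to the nucleus of index [j] inside [b i]. *)
Lemma HB_pos_flat (i : 'I_k) (j : 'I_(n i)) :
  HB_pos ab cc (tagnat.Rank i j) = HB_pos (b i) (c i) j + HB_pos a bc i.
Proof.
rewrite !HB_posE; set s := tagnat.Rank i j.
have -> : psum (fun s => HB_size (cc s)) s =
    psum (fun i => \sum_j HB_size (c i j)) i + psum (fun j => HB_size (c i j)) j.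
  rewrite /s val_Rank -(psum_flat (fun i j => HB_size (c i j))) //.
  exact: ltnW.
have -> : psum (fun l => HB_size (bc l)) i =
    psum (fun l => \sum_q HB_type (b l) q) i + psum (fun l => \sum_j HB_size (c l j)) i.
  by rewrite -psum_add; apply: eq_bigr => l _; rewrite size_HB_comp_sum.
suff -> : psum (HB_type ab) s.+1 =
    psum (HB_type a) i.+1 + (psum (fun l => \sum_q HB_type (b l) q) i + psum (HB_type (b i)) j.+1).
  by lia.
rewrite {1}/psum (sum_type_comp (HB_type a) (fun i => HB_type (b i)) (fun t => t < s.+1)).
have sE : s = psum n i + j :> nat by apply: val_Rank.
have ltj := ltn_ord j; have stepi := psumS n i.
congr (_ + _).
  apply: eq_bigl => l; rewrite ltnS sE; have [li|il] := ltnP l i.+1.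
    by rewrite (leq_trans (leq_psum n (li : l <= i))) ?leq_addr.
  apply/negbTE; rewrite -ltnNge; have := leq_psum n il; rewrite stepi; lia.
rewrite [LHS](@sum_split _ _ i) => [|l il].
  congr (_ + _); last by apply: eq_bigl => q; rewrite ltnS sE leq_add2l.
  apply: eq_bigr => l li; apply: eq_bigl => q; rewrite ltnS sE.
  have := leq_psum n li; rewrite psumS; have := ltn_ord q; lia.
apply: big_pred0 => q; apply/negbTE; rewrite ltnS -ltnNge sE.
by have := leq_psum n il; rewrite stepi; lia.
Qed.

Lemma HB_insert_assoc :
  HB_insert ab cc = HB_insert a bc.
Proof.
pose B i := mkB (HB_order (b i)); pose C i := HB_list (b i) (c i).
pose s := [seq (HB_pos a b i, HB_pos a bc i, B i, C i) | i <- enum 'I_k].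
have gs : good 0 (HB_size a) 0 s.
  apply: good_enum => [i|i i'|i|i|i].
  - rewrite !HB_posE -addnA -psum_add; congr (_ + _).
    by apply: eq_bigr => l _; rewrite size_HB_comp.
  - exact: HB_pos_step.
  - exact: HB_pos_le.
  - exact: HB_size_ge.
  - exact: HB_list_fits.
have := foldl_blocks d0 gs (x := mkB (HB_order a)); rewrite addn0 shift0 => /(_ erefl).
have sE T (f : _ -> T) : [seq f t | t <- s] =
    [seq f (HB_pos a b i, HB_pos a bc i, B i, C i) | i <- enum 'I_k] by rewrite -map_comp.
rewrite foldl_cat /outer /inner /merged !sE /= => e.
rewrite /HB_insert /insert_all; transitivity (foldl (@insertT d) (HB_insert a b)
    (flatten [seq shift (HB_pos a bc i) (C i) | i <- enum 'I_k])).
  rewrite mkB_projT2; congr foldl; rewrite enum_flat map_flatten -map_comp.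
  congr flatten; apply: eq_map => i /=; rewrite /C /HB_list /shift -!map_comp.
  apply: eq_map => j /=; congr pair; first exact: HB_pos_flat.
  by rewrite -[RHS](flat_Rank (fun i j => mkB (HB_order (c i j)))).
rewrite e; congr foldl; apply: eq_map => i /=.
by rewrite mkB_projT2.
Qed.

End Assoc.

(** * Equality of operations *)

Lemma existT_nat_inj (F : nat -> Type) n (x y : F n) :
  existT F n x = existT F n y -> x = y.
Proof. exact: (inj_pair2_eq_dec _ (@eq_comparable nat)). Qed.

Lemma HB_eq d n (a b : HB d n) :
  mkB (HB_order a) = mkB (HB_order b) -> HB_type a = HB_type b -> a = b.
Proof.
case: a b => [N x t h1 h2] [M y t' h3 h4] /= e et.
case: t' / et h4 => h4; have eN : N = M by case: e.
case: M / eN y h3 h4 e => y h3 h4 e.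
rewrite {x e}(existT_nat_inj e : x = y).
by rewrite (bool_irrelevance h1 h3) (eq_irrelevance h2 h4).
Qed.

Lemma HB_op_eq d u n m (a : HB d n) (b : HB d m) : n = m ->
  mkB (HB_order a) = mkB (HB_order b) ->
  (forall (t : 'I_n.+1) (t' : 'I_m.+1), t = t' :> nat -> HB_type a t = HB_type b t') ->
  op_eq (O := HB_operad u) a b.
Proof.
move=> e; case: m / e b => b eo et; congr existT; apply: HB_eq => //.
by apply/ffunP=> t; apply: et.
Qed.

(** The axioms for [O] are equations whose images under [f] are instances of the
    axioms for [P]; injectivity of [f] removes [f]. *)
Lemma operad_embedding (O P : operad_data) (f : forall n, 0 < n -> op_set O n -> op_set P n) :
  is_operad_embedding f -> is_planar_operad P -> is_planar_operad O.
Proof.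
move=> [finj fcomp funit] [assoc unitr unitl].
have reflect n m (hn : 0 < n) (hm : 0 < m) (x : op_set O n) (y : op_set O m) :
    op_eq (f n hn x) (f m hm y) -> op_eq x y.
  rewrite /op_eq => e; have en : n = m by case: e.
  case: m / en hm y e => hm y e; have := existT_nat_inj e.
  by rewrite (bool_irrelevance hm hn) => /finj ->.
split.
- move=> k n p hk hn hp a b c.
  apply: (reflect _ _ (sum_pos (sum_pos hk hn) (fun s => hp (tagnat.sig1 s) (tagnat.sig2 s)))
           (sum_pos hk (fun i => sum_pos (hn i) (hp i)))).
  rewrite !fcomp; have -> : (fun i => f (\sum_j p i j) (sum_pos (hn i) (hp i)) (op_comp (hn i) (hp i) (b i) (c i))) =
      (fun i => op_comp (hn i) (hp i) (f _ (hn i) (b i)) (fun j => f _ (hp i j) (c i j))).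
    by apply: functional_extensionality_dep => i; apply: fcomp.
  exact: (assoc k n p hk hn hp _ _ (fun i j => f _ (hp i j) (c i j))).
- move=> k hk a; apply: (reflect _ _ (sum_pos hk (fun _ => ltn0Sn 0)) hk).
  rewrite fcomp; have -> : (fun _ : 'I_k => f 1 (ltn0Sn 0) (op_unit O)) = (fun _ => op_unit P).
    by apply: functional_extensionality_dep => i; apply: funit.
  exact: unitr.
- move=> n hn a; apply: (reflect _ _ (sum_pos (ltn0Sn 0) (fun _ => hn)) hn).
  by rewrite fcomp funit; apply: unitl.
Qed.

(** * Units *)

Lemma insertT_unit d (x e : bruhats d) j : 0 < d -> projT1 e = d ->
  j + d <= projT1 x -> insertT x (j, e) = x.
Proof.
move=> d0 se jx; apply: bruhats_eq => [/=|f inc bnd]; first by rewrite se addnK.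
rewrite inv_insertT ?se //; last first.
  by move=> i ir; have := bnd i ir; rewrite /= se.
have gap i (ir : i < d.+1) := incr_gap inc (ir : i <= d) (ltnSn d).
have -> : (j <= f 0) && (f d < j + d) = false.
  by apply/negbTE; have := gap 0 (ltn0Sn d); lia.
have er : low d.+1 (j + d) f <= d.+1 by apply: low_le.
have he k (kd : k < d.+1) := low_incr (j + d) inc kd.
set e0 := low _ _ _ in er he *; apply: eq_inv => i ir; rewrite /collapse subnn subn0.
case: ifP => // ie; apply/minn_idPl.
have h : f e0.-1 < j + d by rewrite he; lia.
by have := @incr_gap _ f i e0.-1 inc; lia.
Qed.

Lemma insertT_unit_left d (e y : bruhats d) : 0 < d -> projT1 e = d ->
  d <= projT1 y -> insertT e (0, y) = y.
Proof.
move=> d0 se dy; apply: bruhats_eq => [/=|f inc bnd]; first by rewrite se addKn.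
rewrite inv_insertT ?se //; last by move=> i ir; have := bnd i ir; rewrite /= se.
have -> : (0 <= f 0) && (f d < 0 + projT1 y) = true.
  by have := bnd d (ltnSn d); rewrite /= se; lia.
by apply: eq_inv => i _; rewrite subn0.
Qed.

Lemma foldl_units d (x : bruhats d) (s : seq (nat * bruhats d)) : 0 < d ->
  all (fun t => projT1 t.2 == d) s -> fits (projT1 x) s ->
  foldl (@insertT d) x s = x.
Proof.
move=> d0; elim: s => [|[p b] s IHs] //= /andP[/eqP sb us] /and3P[px _ fs].
by rewrite insertT_unit // IHs //; move: fs; rewrite sb addnK.
Qed.

(** * The two operads *)

Definition HB_unit d : HB d 1 := HB_incl (ltn0Sn 0) (lexB (1 * d) d).

Lemma HB_planar_operad d : 0 < d -> is_planar_operad (HB_operad (HB_unit d)).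
Proof.
move=> d0; split.
- move=> k n p hk hn hp a b c; apply: HB_op_eq.
  + rewrite big_flat; apply: eq_bigr => i _; apply: eq_bigr => j _.
    exact: (flat_Rank p).
  + by rewrite /= !mkB_projT2; apply: HB_insert_assoc.
  + by move=> t t' ett; apply: (type_comp_assoc (HB_type a) (fun i => HB_type (b i)) (fun i j => HB_type (c i j))).
- move=> k hk a; apply: HB_op_eq.
  + by rewrite sum_nat_const card_ord muln1.
  + rewrite /= mkB_projT2; apply: foldl_units => //; last exact: HB_list_fits.
    by rewrite all_map; apply/allP=> i _ /=; rewrite mul1n.
  move=> t t' ett; rewrite /= ffunE [X in _ + X]big1 ?addn0 => [|i _]; last first.
    by rewrite big1 // => q _; rewrite ffunE.
  rewrite (big_pred1 t') // => i.
  have ik : i <= k by rewrite -ltnS.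
  have := psum_const 1 ik; rewrite muln1 /psum => e.
  rewrite -[nuclei_before _ _ == _]/(\sum_(l < k | l < i) 1 == t) e.
  by rewrite ett.
- move=> n hn a; apply: HB_op_eq.
  + by rewrite big_ord1.
  + rewrite /= mkB_projT2 /HB_insert /insert_all enum_ordSl /= enum_ord0 /=.
    have -> : HB_pos (HB_unit d) (fun=> a) ord0 = 0.
      by rewrite HB_posE psum0 addn0 /psum big1 // => i _; rewrite ffunE.
    by apply: insertT_unit_left; rewrite //= ?mul1n //; apply: HB_size_ge.
  move=> t t' ett; rewrite /= ffunE big1 ?add0n => [|i _]; last by rewrite ffunE.
  rewrite big_ord1; rewrite (big_pred1 t') // => i.
  have -> : nuclei_before (fun _ : 'I_1 => n) (ord0 : 'I_1) = 0 by exact: (psum0 (fun _ : 'I_1 => n)).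
  by rewrite add0n ett.
Qed.

Lemma mkB_ecast d N M (e : N = M) (b : bruhat N d) :
  mkB (ecast N (bruhat N d) e b) = mkB b.
Proof. by case: M / e. Qed.

Lemma HB_incl_embedding d : 0 < d ->
  is_operad_embedding (O := HB0_operad d) (P := HB_operad (HB_unit d)) (@HB_incl d).
Proof.
move=> d0; split=> //.
- move=> n hn x y e.
  exact: (existT_nat_inj (congr1 (fun a => mkB (HB_order a)) e)).
- move=> k n hk hn a b; apply: HB_eq.
    rewrite /= mkB_ecast !mkB_projT2 /HB0_insert /HB_insert /insert_all.
    congr foldl; apply: eq_map => i; congr pair.
    rewrite HB_posE /HB0_pos /psum [X in _ = X + _]big1 ?add0n => [|l _]; last by rewrite ffunE.
    by rewrite big_distrr; apply: eq_bigr => l _; apply: mulnC.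
  apply/ffunP=> t; rewrite !ffunE !big1 // => i _; rewrite ?ffunE //.
  by rewrite big1 // => q _; rewrite ffunE.
Qed.

Theorem theorem6p2 (d : nat) (hd : 0 < d) :
  insertion_well_defined d /\
  exists u : HB d 1,
    is_planar_operad (HB_operad u) /\
    is_planar_operad (HB0_operad d) /\
    is_operad_embedding (O := HB0_operad d) (P := HB_operad u) (@HB_incl d).
Proof.
have emb := HB_incl_embedding hd; have op := HB_planar_operad hd.
split; first exact: Inv_insertion.
by exists (HB_unit d); split=> //; split=> //; apply: operad_embedding emb op.
Qed.
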